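(* The homeomorphism relation of compacta is continuously bireducible with the homeomorphism relation of absolute retracts. That is, writing $\mathcal{AR}\subseteq 2^Q$ for the set of all absolute retracts $K\in 2^Q$, there exist a continuous map $f\colon 2^Q\to \mathcal{AR}$ such that for all $K,L\in 2^Q$, $K$ is homeomorphic to $L$ if and only if $f(K)$ is homeomorphic to $f(L)$, and a continuous map $g\colon \mathcal{AR}\to 2^Q$ such that for all $K,L\in\mathcal{AR}$, $K$ is homeomorphic to $L$ if and only if $g(K)$ is homeomorphic to $g(L)$.
   Context: $I=[0,1]$ and $Q=I^{\mathbb N}$ is the Hilbert cube. $2^Q$ is the hyperspace of all (nonempty) compact subsets of $Q$ with the Hausdorff metric. Every class $\mathcal C$ of metrizable compacta is coded by $\mathcal C\cap 2^Q$ with the subspace topology. An absolute retract is any space that is (homeomorphic to) a retract of the Hilbert cube. *)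

(* Defs.v *)
From HB Require Import structures.
From mathcomp Require Import all_boot all_order all_algebra finmap.
From mathcomp Require Import all_classical all_reals all_analysis.
From mathcomp Require Import lra.

Set Implicit Arguments.
Unset Strict Implicit.
Unset Printing Implicit Defensive.

Import Order.TTheory GRing.Theory Num.Theory.
Import numFieldTopology.Exports numFieldNormedType.Exports.

Local Open Scope classical_set_scope.
Local Open Scope ring_scope.

(* The uniform structure, hence the topology, is that of the product of
   countably many copies of [0, 1]; the metric instance below is proved
   compatible with it when it is declared. *)
Definition hilbert_cube (R : realType) : Type :=
  prod_topology (fun _ : nat => set_type [set` `[0 : R, 1]]).

HB.instance Definition _ (R : realType) := Uniform.copy (hilbert_cube R)
  (prod_topology (fun _ : nat => set_type [set` `[0 : R, 1]])).

Section hilbert_cube_metric.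
Context {R : realType}.
Implicit Types x y z : hilbert_cube R.

Definition cube_gap x y (n : nat) : R :=
  `|set_val (x n) - set_val (y n)| / 2 ^+ n.

Definition cube_dist x y : R := sup (range (cube_gap x y)).

Let coord01 x n : 0 <= (set_val (x n) : R) <= 1.
Proof.
by move: (x n) => [r /= rP]; rewrite set_valE/=; move/set_mem : rP; rewrite /= in_itv.
Qed.

Let pow2_gt0 n : 0 < 2 ^+ n :> R. Proof. by rewrite exprn_gt0. Qed.

Let gap_le2 x y n : cube_gap x y n <= (2 ^+ n)^-1.
Proof.
rewrite /cube_gap ler_pdivrMr// mulVf ?gt_eqF//.
have /andP[x0 x1] := coord01 x n; have /andP[y0 y1] := coord01 y n.
by rewrite ler_norml; apply/andP; split; lra.
Qed.

Let gap_le1 x y n : cube_gap x y n <= 1.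
Proof.
by rewrite (le_trans (gap_le2 _ _ _))// invf_le1// exprn_ege1// ler1n.
Qed.

Let gap_ge0 x y n : 0 <= cube_gap x y n.
Proof. by rewrite /cube_gap divr_ge0// ltW. Qed.

Let gap_le x y n : cube_gap x y n <= cube_dist x y.
Proof.
by apply: ub_le_sup; [exists 1 => _ [m _ <-]; exact: gap_le1|exists n].
Qed.

Let dist_le x y e : (forall n, cube_gap x y n <= e) -> cube_dist x y <= e.
Proof.
by move=> h; apply: ge_sup; [exists (cube_gap x y 0); exists 0|move=> _ [n _ <-]].
Qed.

Let distxx x : cube_dist x x = 0.
Proof.
apply/eqP; rewrite eq_le (le_trans (gap_ge0 x x 0) (gap_le _ _ _)) andbT.
by apply: dist_le => n; rewrite /cube_gap subrr normr0 mul0r.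
Qed.

Let cube_dist_ge0 x y : 0 <= cube_dist x y.
Proof. exact: le_trans (gap_ge0 x y 0) (gap_le _ _ _). Qed.

Let cube_dist_positivity x y : cube_dist x y = 0 -> x = y.
Proof.
move=> d0; apply/funext => n; apply: val_inj.
have : cube_gap x y n == 0 by rewrite eq_le gap_ge0 -d0 gap_le.
rewrite /cube_gap mulf_eq0 invr_eq0 (gt_eqF (pow2_gt0 n)) orbF normr_eq0 subr_eq0.
by move=> /eqP; rewrite set_valE.
Qed.

Let cube_dist_sym x y : cube_dist x y = cube_dist y x.
Proof.
rewrite /cube_dist; suff -> : cube_gap x y = cube_gap y x by [].
by apply/funext => n; rewrite /cube_gap distrC.
Qed.

Let cube_dist_triangle y x z : cube_dist x z <= cube_dist x y + cube_dist y z.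
Proof.
apply: dist_le => n; apply: le_trans (lerD (gap_le x y n) (gap_le y z n)).
by rewrite /cube_gap -mulrDl ler_pM2r ?invr_gt0// ler_distD.
Qed.

Definition cube_ball x e : set (hilbert_cube R) := [set y | cube_dist x y < e].

Let ball_center x (e : R) : 0 < e -> cube_ball x e x.
Proof. by rewrite /cube_ball/= distxx. Qed.

Let ball_sym x y (e : R) : cube_ball x e y -> cube_ball y e x.
Proof. by rewrite /cube_ball/= cube_dist_sym. Qed.

Let ball_triangle x y z e1 e2 :
  cube_ball x e1 y -> cube_ball y e2 z -> cube_ball x (e1 + e2) z.
Proof.
by rewrite /cube_ball/= => ? ?; rewrite (le_lt_trans (cube_dist_triangle y _ _))// ltrD.
Qed.

Let cube_coord := set_type [set` `[0 : R, 1]].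

Let ent_proj (i : nat) (A : set (hilbert_cube R * hilbert_cube R)) :
  @entourage (initial_topology (@proj _ (fun _ : nat => cube_coord) i)) A ->
  @entourage (hilbert_cube R) A.
Proof.
move=> entA; pose p : {classic nat} * set (hilbert_cube R * hilbert_cube R) := (i, A).
have pP : `[< @entourage
    (initial_topology (@proj _ (fun _ : nat => cube_coord) p.1)) p.2 >].
  exact/asboolP.
exists A => //; exists [fset exist _ p pP]%fset; first by move=> ? _; exact: in_setT.
rewrite set_fset1 bigcap_set1//.
Qed.

Let ent_coord (i : nat) (e : R) : 0 < e ->
  @entourage (hilbert_cube R)
    [set xy | `|set_val (xy.1 i) - set_val (xy.2 i)| < e].
Proof.
move=> e0; apply: (ent_proj (i := i)).
exists [set xy | `|set_val xy.1 - set_val xy.2| < e] => //.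
exists [set xy : R * R | `|xy.1 - xy.2| < e] => //.
by rewrite -entourage_ballE; exists e.
Qed.

Let ent_ball_filter : Filter (entourage_ cube_ball).
Proof.
apply: filter_from_filter; first by exists 1 => /=.
move=> e1 e2 /= e10 e20; exists (Num.min e1 e2); first by rewrite /= lt_min e10.
by move=> xy /=; rewrite /cube_ball/= lt_min => /andP[].
Qed.

Let cube_entourageE : @entourage (hilbert_cube R) = entourage_ cube_ball.
Proof.
apply/seteqP; split=> A.
- move=> [_ [F _ <-] FA]; apply: (@filterS _ _ ent_ball_filter _ _ FA).
  apply: (@filter_bigI _ _ _ _ _ ent_ball_filter) => -[[i w] /= /asboolP [B [C]]] + BC Bw _.
  rewrite -entourage_ballE => -[e /= e0 eC]; exists (e / 2 ^+ i); first by rewrite /= divr_gt0.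
  move=> xy /= /(le_lt_trans (gap_le _ _ i)); rewrite /cube_gap ltr_pM2r ?invr_gt0// => h.
  by apply/Bw/BC/eC.
- move=> [e /= e0 eA].
  have entF : Filter (@entourage (hilbert_cube R)) by exact: entourage_filter.
  apply: (@filterS _ _ entF _ _ eA).
  have [N Ne] : exists N, (2 ^+ N)^-1 < e / 2.
    have [N _ /(_ N (leqnn N))] := near_infty_natSinv_expn_lt (PosNum (divr_gt0 e0 (ltr0Sn R 1))).
    by rewrite /= mul1r => ?; exists N.
  have : @entourage (hilbert_cube R) (\bigcap_(i in [set` [fset i in iota 0 N]%fset])
      [set xy | `|set_val (xy.1 i) - set_val (xy.2 i)| < e / 2]).
    by apply: (@filter_bigI _ _ _ _ _ entF) => i _; apply: ent_coord; rewrite divr_gt0.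
  apply: (@filterS _ _ entF) => -[x y] /= h; rewrite /cube_ball/=.
  apply: (@le_lt_trans _ _ (e / 2)); last by rewrite ltr_pdivrMr// ltr_pMr// ltr1n.
  apply: dist_le => n; have [nN|Nn] := ltnP n N.
    have /h/ltW : [set` [fset i in iota 0 N]%fset] n.
      by rewrite /= !inE mem_iota add0n.
    by apply: le_trans; rewrite /cube_gap ler_pdivrMr// ler_peMr// exprn_ege1// ler1n.
  apply/ltW/(le_lt_trans (gap_le2 x y n))/(le_lt_trans _ Ne).
  by rewrite lef_pV2 ?posrE// ler_weXn2l// ler1n.
Qed.

HB.instance Definition _ := @Uniform_isPseudoMetric.Build R (hilbert_cube R)
  cube_ball ball_center ball_sym ball_triangle cube_entourageE.

Let ballEcube x d : ball x d = [set y | cube_dist x y < d]. Proof. by []. Qed.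

HB.instance Definition _ := @PseudoMetric_isMetric.Build R (hilbert_cube R)
  cube_dist cube_dist_ge0 cube_dist_positivity ballEcube.

End hilbert_cube_metric.

(* 2^M : the empty set is excluded, so that the Hausdorff distance is a genuine
   metric with finite values. *)
Record hyperspace (R : realType) (M : metricType R) := Hyperspace {
  hyperspace_set :> set M ;
  hyperspace_nonempty : hyperspace_set !=set0 ;
  hyperspace_compact : compact hyperspace_set }.

HB.instance Definition _ (R : realType) (M : metricType R) :=
  gen_eqMixin (hyperspace M).
HB.instance Definition _ (R : realType) (M : metricType R) :=
  gen_choiceMixin (hyperspace M).

Section hausdorff_metric.
Context {R : realType} {M : metricType R}.
Implicit Types (a b x : M) (A B C : set M) (K L N : hyperspace M).

Definition point_dist x A : R := inf [set mdist x a | a in A].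

Definition hausdorff_dist A B : R :=
  Num.max (sup [set point_dist a B | a in A])
          (sup [set point_dist b A | b in B]).

Let pd_le x a A : A a -> point_dist x A <= mdist x a.
Proof.
move=> Aa; apply: ge_inf; last by exists a.
by exists 0 => _ [b _ <-]; exact: mdist_ge0.
Qed.

Let pd_ge x A r : A !=set0 -> (forall a, A a -> r <= mdist x a) ->
  r <= point_dist x A.
Proof.
by move=> [a Aa] h; apply: lb_le_inf; [exists (mdist x a); exists a|move=> _ [b Ab <-]; exact: h].
Qed.

Let pd_triangle x b A : A !=set0 -> point_dist x A <= mdist x b + point_dist b A.
Proof.
move=> A0; rewrite addrC -lerBlDr; apply: pd_ge => // a Aa.
rewrite lerBlDr addrC; apply: le_trans (metric_triangle x b a).
exact: pd_le.
Qed.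

Let pd_self x A : A x -> point_dist x A = 0.
Proof.
move=> Ax; apply/eqP; rewrite eq_le -{1}(mdistxx x) pd_le//=.
by apply: pd_ge => [|a _]; [exists x|exact: mdist_ge0].
Qed.

Let pd_ub A B : compact A -> A !=set0 -> B !=set0 ->
  has_ubound [set point_dist a B | a in A].
Proof.
move=> cA [a0 Aa0] [b0 Bb0].
have cd : {within A, continuous (mdist a0 : M -> R)}.
  apply: continuous_subspaceT => x; apply/(@cvgrPdist_lt _ R^o) => e e0; near=> y.
  have xy : mdist x y < e.
    by near: y; apply/metricType_numDomainType.nbhs_mdistP; exists e.
  apply: le_lt_trans xy; rewrite ler_norml; apply/andP; split.
    by have := metric_triangle a0 x y; lra.
  by have := metric_triangle a0 y x; rewrite (metric_sym y x); lra.
have [r [_ /(_ (r + 1)) h]] := compact_bounded (continuous_compact cd cA).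
exists (r + 1 + mdist a0 b0) => _ [a Aa <-].
apply: le_trans (pd_le a Bb0) _.
apply: le_trans (metric_triangle a a0 b0) _; rewrite lerD2r metric_sym.
apply: le_trans (ler_norm _) _; apply: h; first by rewrite ltrDl.
by exists a.
Unshelve. all: by end_near. Qed.

Let pd_hd K L a : hyperspace_set K a -> point_dist a L <= hausdorff_dist K L.
Proof.
move=> Ka; rewrite /hausdorff_dist le_max; apply/orP; left.
apply: ub_le_sup; last by exists a.
by apply: pd_ub; [exact: hyperspace_compact|exists a|exact: hyperspace_nonempty].
Qed.

Let hd_sym K L : hausdorff_dist K L = hausdorff_dist L K.
Proof. by rewrite /hausdorff_dist maxC. Qed.

Let hd_le K L r : (forall a, hyperspace_set K a -> point_dist a L <= r) ->
  (forall b, hyperspace_set L b -> point_dist b K <= r) -> hausdorff_dist K L <= r.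
Proof.
move=> hK hL; rewrite /hausdorff_dist ge_max; apply/andP; split.
- have [a Ka] := hyperspace_nonempty K.
  by apply: ge_sup; [exists (point_dist a L); exists a|move=> _ [b Kb <-]; exact: hK].
- have [a La] := hyperspace_nonempty L.
  by apply: ge_sup; [exists (point_dist a K); exists a|move=> _ [b Lb <-]; exact: hL].
Qed.

Let hd_xx K : hausdorff_dist K K = 0.
Proof.
apply/eqP; rewrite eq_le; apply/andP; split.
  by apply: hd_le => a Ka; rewrite pd_self.
by have [a Ka] := hyperspace_nonempty K; rewrite -(pd_self Ka); exact: pd_hd.
Qed.

Let pd_eq0 L a : point_dist a L <= 0 -> hyperspace_set L a.
Proof.
move=> aL; have /closure_id -> : closed (L : set M).
  by apply: compact_closed; [exact: metric_hausdorff|exact: hyperspace_compact].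
move=> U; rewrite -filter_from_ballE => -[e /= e0 eU].
have : point_dist a L < e by exact: le_lt_trans e0.
move=> /inf_lt; case.
  by have [b Lb] := hyperspace_nonempty L; exists (mdist a b); exists b.
by move=> _ [b Lb <-] abe; exists b; split => //; apply: eU; rewrite ballEmdist.
Qed.

Let hd_positivity K L : hausdorff_dist K L = 0 -> K = L.
Proof.
move=> KL0; have KL : (K : set M) = L.
  apply/seteqP; split=> a h; apply: pd_eq0; rewrite -KL0; first exact: pd_hd.
  by rewrite hd_sym; exact: pd_hd.
move: K L KL {KL0} => [K K0 Kc] [L L0 Lc] /= KL; subst L.
by congr Hyperspace; exact: Prop_irrelevance.
Qed.

Let pd_hd_triangle K L x : point_dist x L <= point_dist x K + hausdorff_dist K L.
Proof.
rewrite -lerBlDr; apply: pd_ge; first exact: hyperspace_nonempty.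
move=> a Ka; rewrite lerBlDr.
apply: le_trans (pd_triangle x a (hyperspace_nonempty L)) _.
by rewrite lerD2l; exact: pd_hd.
Qed.

Let hd_triangle L K N :
  hausdorff_dist K N <= hausdorff_dist K L + hausdorff_dist L N.
Proof.
apply: hd_le => a h.
  by apply: le_trans (pd_hd_triangle L N a) _; rewrite lerD2r pd_hd.
apply: le_trans (pd_hd_triangle L K a) _.
by rewrite addrC (hd_sym L K) lerD2l (hd_sym L N) pd_hd.
Qed.

HB.instance Definition _ := @isMetric.Build R (hyperspace M)
  (fun K L => hausdorff_dist K L) hd_xx hd_positivity hd_sym hd_triangle.

End hausdorff_metric.

Definition homeomorphic (X Y : topologicalType) : Prop :=
  exists (f : X -> Y) (g : Y -> X),
    [/\ cancel f g, cancel g f, continuous f & continuous g].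

(* The retraction has the subtype A, with its subspace topology, as codomain. *)
Definition is_retract (X : topologicalType) (A : set X) : Prop :=
  exists r : X -> set_type A, continuous r /\ forall a : A, r (set_val a) = a.

Definition absolute_retract (R : realType) (X : topologicalType) : Prop :=
  exists A : set (hilbert_cube R), is_retract A /\ homeomorphic X (set_type A).

Definition AR (R : realType) : set (hyperspace (hilbert_cube R)) :=
  [set K | absolute_retract R (set_type K)].

Definition continuously_reducible (X Y : topologicalType)
    (E : X -> X -> Prop) (F : Y -> Y -> Prop) : Prop :=
  exists f : X -> Y, continuous f /\ forall x y, E x y <-> F (f x) (f y).

Definition continuously_bireducible (X Y : topologicalType)
    (E : X -> X -> Prop) (F : Y -> Y -> Prop) : Prop :=
  continuously_reducible E F /\ continuously_reducible F E.

Definition homeo_compacta (R : realType)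
    (K L : hyperspace (hilbert_cube R)) : Prop :=
  homeomorphic (set_type K) (set_type L).

Definition homeo_AR (R : realType) (K L : set_type (@AR R)) : Prop :=
  homeo_compacta (set_val K) (set_val L).

(* Main.v *)
(* Fix a sequence [q n] of points of the cube and radii [eps n -> 0] such that
   every point lies within [eps n] of [q n] for arbitrarily large [n].  Put a
   copy of a compactum [K] in the base [x_0 = 0] of the cube, next to it a
   discrete sequence of points [foot n], with [foot n] at distance about
   [2^-n + d(q n, K)] from the copy, and attach to the base a hair of length
   [max (0, eps n - d(q n, K))] at [foot n].  The resulting brush depends
   continuously on [K].  The feet of the nondegenerate hairs accumulate exactly
   at [K], and since the lengths of the hairs tend to 0, the cube retracts onto
   the brush.

   The points of [K] are the non-cut points of the brush that are limits both of
   cut points and of other non-cut points, so that homeomorphic brushes come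
   from homeomorphic compacta.  Conversely, a homeomorphism from [K] to [L]
   extends, by a Schroeder-Bernstein matching of the feet, to one between the
   compacta consisting of the copy and the feet; these lie in one half of the
   coordinates of the base, so that Klee's trick and Tietze's theorem extend it
   to a homeomorphism of the base, and the hairs are then rescaled linearly. *)
Require Import Defs.
From HB Require Import structures.
From mathcomp Require Import all_boot all_order all_algebra finmap.
From mathcomp Require Import all_classical all_reals all_analysis.
From mathcomp Require Import lra ring.

Set Implicit Arguments.
Unset Strict Implicit.
Unset Printing Implicit Defensive.

Import Order.TTheory GRing.Theory Num.Theory.
Import numFieldTopology.Exports numFieldNormedType.Exports.

Local Open Scope classical_set_scope.
Local Open Scope ring_scope.

(** * Coordinates and metric of the Hilbert cube *)

Section cube_coordinates.
Context {R : realType}.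
Local Notation Q := (hilbert_cube R).

Definition crd (x : Q) (n : nat) : R := set_val (x n).

Definition clip (r : R) : R := Num.max 0 (Num.min 1 r).

Lemma clip_itv r : clip r \in [set` `[0 : R, 1]].
Proof.
apply/mem_set; rewrite /clip /= in_itv /=.
by rewrite le_max lexx ge_max ge_min ler01 lexx.
Qed.

Lemma clip_id r : 0 <= r <= 1 -> clip r = r.
Proof. by move=> /andP[r0 r1]; rewrite /clip min_r// max_r. Qed.

(** Clipping turns every real sequence into a point of the cube, so that maps into the cube can be
    given by plain formulas; [crd_mk_id] removes the clipping where the values lie in [0, 1]. *)
Definition mkcube (g : nat -> R) : Q := fun n => exist _ (clip (g n)) (clip_itv (g n)).

Lemma crd_mk g n : crd (mkcube g) n = clip (g n).
Proof. by rewrite /crd set_valE. Qed.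

Lemma crd_itv x n : 0 <= crd x n <= 1.
Proof.
by rewrite /crd; case: (x n) => r rP; rewrite set_valE /=; move/set_mem : rP; rewrite /= in_itv.
Qed.

Lemma crd_ge0 x n : 0 <= crd x n. Proof. by case/andP: (crd_itv x n). Qed.
Lemma crd_le1 x n : crd x n <= 1. Proof. by case/andP: (crd_itv x n). Qed.

Lemma crd_mk_id g n : 0 <= g n <= 1 -> crd (mkcube g) n = g n.
Proof. by move=> h; rewrite crd_mk clip_id. Qed.

Lemma crd_inj x y : (forall n, crd x n = crd y n) -> x = y.
Proof. by move=> h; apply/funext => n; apply: val_inj; have := h n; rewrite /crd set_valE. Qed.

Lemma continuous_crd n : continuous (crd^~ n).
Proof.
move=> x; apply: (@continuous_comp _ _ _ (fun y : Q => y n) set_val).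
  exact: (@proj_continuous nat (fun=> set_type [set` `[0 : R, 1]]) n).
exact: initial_continuous.
Qed.

Lemma continuous_maxr (T : topologicalType) (f g : T -> R) :
  continuous f -> continuous g -> continuous (fun z => Num.max (f z) (g z)).
Proof. by move=> cf cg x; exact: (@continuous_max R T f g x (cf x) (cg x)). Qed.

Lemma continuous_minr (T : topologicalType) (f g : T -> R) :
  continuous f -> continuous g -> continuous (fun z => Num.min (f z) (g z)).
Proof. by move=> cf cg x; exact: (@continuous_min R T f g x (cf x) (cg x)). Qed.

Lemma continuous_addr (T : topologicalType) (f g : T -> R) :
  continuous f -> continuous g -> continuous (fun z => f z + g z).
Proof. by move=> cf cg x; apply: (@cvgD _ R^o); [exact: cf|exact: cg]. Qed.

Lemma continuous_subr (T : topologicalType) (f g : T -> R) :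
  continuous f -> continuous g -> continuous (fun z => f z - g z).
Proof. by move=> cf cg x; apply: (@cvgB _ R^o); [exact: cf|exact: cg]. Qed.

Lemma continuous_mulr (T : topologicalType) (f g : T -> R) :
  continuous f -> continuous g -> continuous (fun z => f z * g z).
Proof. by move=> cf cg x; apply: (@cvgM R); [exact: cf|exact: cg]. Qed.

Lemma continuous_clip (T : topologicalType) (f : T -> R) :
  continuous f -> continuous (fun z => clip (f z)).
Proof.
move=> cf; apply: continuous_maxr; first exact: cst_continuous.
by apply: continuous_minr => //; exact: cst_continuous.
Qed.

Lemma gap_le1 (x y : Q) n : cube_gap x y n <= 1.
Proof.
rewrite /cube_gap ler_pdivrMr ?exprn_gt0// mul1r (@le_trans _ _ 1)// ?exprn_ege1// ?ler1n//.
have := crd_itv x n; have := crd_itv y n; rewrite /crd => /andP[? ?] /andP[? ?].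
by rewrite ler_norml; apply/andP; split; lra.
Qed.

Lemma crd_dist (x y : Q) n : `|crd x n - crd y n| <= 2 ^+ n * mdist x y.
Proof.
rewrite -ler_pdivrMl ?exprn_gt0// mulrC.
by apply: ub_le_sup; [exists 1 => _ [m _ <-]; exact: gap_le1|exists n].
Qed.

Lemma mdist_le (x y : Q) e :
  (forall n, `|crd x n - crd y n| <= 2 ^+ n * e) -> mdist x y <= e.
Proof.
move=> h; apply: ge_sup; first by exists (cube_gap x y 0); exists 0%N.
by move=> _ [n _ <-]; rewrite /cube_gap ler_pdivrMr ?exprn_gt0// mulrC; exact: h.
Qed.

Lemma mdist_le1 (x y : Q) : mdist x y <= 1.
Proof.
apply: mdist_le => n; rewrite mulr1 (@le_trans _ _ 1)// ?exprn_ege1// ?ler1n//.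
have /andP[? ?] := crd_itv x n; have /andP[? ?] := crd_itv y n.
by rewrite ler_norml; apply/andP; split; lra.
Qed.

Lemma pow2V_lt (e : R) : 0 < e -> exists N, forall n, (N <= n)%N -> (2 ^+ n)^-1 < e.
Proof.
move=> e0; have [N _ h] := near_infty_natSinv_expn_lt (PosNum e0).
by exists N => n Nn; have := h n Nn; rewrite /= mul1r.
Qed.

(** The distance is a supremum of coordinate differences weighted by 2^-n, so the coordinates from
    [N] on contribute at most 2^-N. *)
Lemma mdist_lt_crd (x y : Q) N e : 0 < e -> (2 ^+ N)^-1 < e ->
  (forall n, (n < N)%N -> `|crd x n - crd y n| < e) -> mdist x y <= e.
Proof.
move=> e0 Ne h; apply: mdist_le => n; have [nN|Nn] := ltnP n N.
  by apply/ltW/(lt_le_trans (h n nN)); rewrite ler_peMl ?exprn_ege1 ?ler1n// ltW.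
have : 1 <= 2 ^+ n * e.
  rewrite -ler_pdivrMl ?exprn_gt0// mulr1; apply/ltW/(le_lt_trans _ Ne).
  by rewrite lef_pV2 ?posrE ?exprn_gt0// ler_weXn2l// ler1n.
apply: le_trans; have /andP[? ?] := crd_itv x n; have /andP[? ?] := crd_itv y n.
by rewrite ler_norml; apply/andP; split; lra.
Qed.

Lemma continuous_mdistP (T : topologicalType) (M : metricType R) (f : T -> M) :
  continuous f <-> forall x e, 0 < e -> \forall y \near x, mdist (f x) (f y) < e.
Proof.
split => h x; first by move=> e e0; exact: (metricType_numDomainType.cvgr_dist_lt (h x)).
by apply/metricType_numDomainType.cvgrPdist_lt => e e0; exact: h.
Qed.

Lemma continuous_to_cube (T : topologicalType) (f : T -> Q) :
  (forall n, continuous (fun z => crd (f z) n)) -> continuous f.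
Proof.
move=> h; apply/continuous_mdistP => x e e0.
have e2 : 0 < e / 2 by rewrite divr_gt0.
have [N /(_ N (leqnn N)) Ne] := pow2V_lt e2.
have : \forall y \near x, forall i : 'I_N, `|crd (f x) i - crd (f y) i| < e / 2.
  by apply: filter_forall => i; exact: (@cvgr_dist_lt _ R^o _ _ _ _ _ (h i x)).
apply: filterS => y hy; apply: (@le_lt_trans _ _ (e / 2)); last lra.
by apply: mdist_lt_crd Ne _ => // n nN; exact: (hy (Ordinal nN)).
Qed.

Lemma continuous_mkcube (T : topologicalType) (g : T -> nat -> R) :
  (forall n, continuous (fun z => g z n)) -> continuous (fun z => mkcube (g z)).
Proof.
move=> h; apply: continuous_to_cube => n.
rewrite (_ : (fun _ => _) = fun z => clip (g z n)); first exact: continuous_clip.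
by apply/funext => z; rewrite crd_mk.
Qed.

Lemma cube_compact : compact [set: Q].
Proof.
have cI : compact [set: set_type [set` `[0 : R, 1]]].
  pose c (r : R) : set_type [set` `[0 : R, 1]] := exist _ (clip r) (clip_itv r).
  have -> : [set: set_type [set` `[0 : R, 1]]] = c @` `[0, 1]%classic.
    apply/seteqP; split => // -[r rP] _; have r01 := set_mem rP.
    exists r => //; apply: val_inj => /=; apply: clip_id.
    by move: r01; rewrite /= in_itv.
  apply: continuous_compact; last exact: segment_compact.
  apply: continuous_subspaceT; apply: continuous_comp_initial.
  rewrite (_ : _ \o _ = clip); first by apply: continuous_clip => x; exact: cvg_id.
  by apply/funext => r /=; rewrite set_valE.
have -> : [set: Q] = [set f : Q | forall i, setT (f i)] by apply/seteqP; split.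
exact: (@tychonoff nat (fun=> set_type [set` `[0 : R, 1]]) (fun=> setT) (fun=> cI)).
Qed.

Lemma near_mdist (M : metricType R) (x : M) e : 0 < e -> \forall y \near x, mdist x y < e.
Proof. by move=> e0; apply/metricType_numDomainType.nbhs_mdistP; exists e. Qed.

Lemma continuous_mdist (M : metricType R) (a : M) : continuous (mdist a).
Proof.
move=> x; apply/(@cvgrPdist_lt _ R^o) => e e0.
apply: filterS (near_mdist x e0) => y xy; apply: le_lt_trans xy; rewrite ler_norml; apply/andP; split.
  by have := metric_triangle a x y; lra.
by have := metric_triangle a y x; rewrite (metric_sym y x); lra.
Qed.
End cube_coordinates.

(** * Brushes are retracts of the cube *)

(** One-sided, but the same as convergence to 0 for the nonnegative sequences to which it is
    applied. *)
Definition vanishing (R : realType) (a : nat -> R) :=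
  forall e, 0 < e -> exists M, forall n, (M <= n)%N -> a n < e.

(** The selector [N] may be discontinuous. At each point at most the term of index [N x] is nonzero,
    so the map is the sum of all [g n], and the bounds [a n] make it a uniform limit of the
    continuous partial sums. *)
Lemma continuous_selected (R : realType) (T : topologicalType) (g : nat -> T -> R)
    (N : T -> nat) (a : nat -> R) :
  (forall n, continuous (g n)) -> (forall n x, n <> N x -> g n x = 0) ->
  (forall n x, `|g n x| <= a n) -> vanishing a ->
  continuous (fun x => g (N x) x).
Proof.
move=> cg g0 ga a0 x; apply/(@cvgrPdist_lt _ R^o) => e e0.
have e3 : 0 < e / 3 by rewrite divr_gt0.
have [M aM] := a0 _ e3.
pose S y := \sum_(n < M) g n y.
have cS : continuous S.
  rewrite /S; elim: (M) => [|m IH].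
    by under eq_fun do rewrite big_ord0; exact: cst_continuous.
  by under eq_fun do rewrite big_ord_recr; exact: continuous_addr.
have gS y : `|g (N y) y - S y| < e / 3.
  have [NM|MN] := ltnP (N y) M.
    rewrite /S (bigD1 (Ordinal NM))//= big1 ?addr0 ?subrr ?normr0// => i /eqP iN.
    by apply: g0 => iNy; apply: iN; exact: val_inj.
  rewrite /S big1 ?subr0 => [|i _]; first exact: le_lt_trans (ga _ _) (aM _ MN).
  by apply: g0 => iN; move: (ltn_ord i); rewrite iN ltnNge MN.
have : \forall y \near x, `|S x - S y| < e / 3 by exact: (@cvgr_dist_lt _ R^o _ _ _ _ _ (cS x)).
apply: filterS => y xy; have gx := gS x; have gy := gS y.
rewrite (_ : _ - _ = (g (N x) x - S x) + (S x - S y) - (g (N y) y - S y)); last by ring.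
by apply: le_lt_trans (ler_normB _ _) _; have := ler_normD (g (N x) x - S x) (S x - S y); lra.
Qed.

Section brush.
Context {R : realType}.
Local Notation Q := (hilbert_cube R).
Implicit Types (x y : Q) (s t : R).

Definition raise s x : Q := mkcube (fun i => if i is _.+1 then crd x i else s).

Lemma crd_raiseS s x i : crd (raise s x) i.+1 = crd x i.+1.
Proof. by rewrite crd_mk_id// crd_itv. Qed.

Lemma crd_raise0 s x : 0 <= s <= 1 -> crd (raise s x) 0 = s.
Proof. by move=> h; rewrite crd_mk_id. Qed.

Lemma crd_raise00 x : crd (raise 0 x) 0 = 0.
Proof. by rewrite crd_raise0 ?lexx ?ler01. Qed.

Lemma raise_raise s t x : raise s (raise t x) = raise s x.
Proof. by apply: crd_inj => -[|i]; rewrite ?crd_raiseS// !crd_mk. Qed.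

Lemma raise_id x : raise (crd x 0) x = x.
Proof. by apply: crd_inj => -[|i]; rewrite ?crd_raiseS ?crd_raise0 ?crd_itv. Qed.

Lemma continuous_raise0 : continuous (raise 0).
Proof. by apply: continuous_mkcube => -[|i]; [exact: cst_continuous|exact: continuous_crd]. Qed.

(* Besides the height coordinate 0, the cube is split into two cubes, with the
   odd and the positive even coordinates. *)
Definition place t (q : Q) : Q := mkcube (fun i =>
  if i is k.+1 then
    if odd k then 2^-1 else if k./2 is j.+1 then 4^-1 + crd q j / 2 else 4^-1 + t / 4
  else 0).

Lemma crd_place0 t q : crd (place t q) 0 = 0.
Proof. by rewrite crd_mk_id ?lexx ?ler01. Qed.

Lemma crd_place_even t q j : crd (place t q) j.*2.+2 = 2^-1.
Proof. by rewrite crd_mk_id /= odd_double//=; apply/andP; split; lra. Qed.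

Lemma crd_place1 t q : 0 <= t <= 1 -> crd (place t q) 1 = 4^-1 + t / 4.
Proof. by move=> /andP[? ?]; rewrite crd_mk_id//=; apply/andP; split; lra. Qed.

Lemma crd_place_odd t q j : crd (place t q) j.+1.*2.+1 = 4^-1 + crd q j / 2.
Proof.
have /andP[? ?] := crd_itv q j.
by rewrite crd_mk_id /= ?odd_double ?doubleK//=; apply/andP; split; lra.
Qed.

Lemma raise_place t q : raise 0 (place t q) = place t q.
Proof. by rewrite -{2}(raise_id (place t q)) crd_place0. Qed.

Lemma nat_place_cases i :
  [\/ i = 0%N, i = 1%N, exists j, i = j.*2.+2 | exists j, i = j.+1.*2.+1].
Proof.
case: i => [|k]; first by constructor 1.
rewrite -[k]odd_double_half; case: (odd k) => /=; first by constructor 3; exists k./2.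
by case: k./2 => [|j]; [constructor 2|constructor 4; exists j].
Qed.

(** Coordinate j of [q] goes to coordinate 2j + 3, which has a smaller weight, and [t] is divided by
    4 in coordinate 1, so neither contribution grows. *)
Lemma mdist_place t t' q q' : 0 <= t <= 1 -> 0 <= t' <= 1 ->
  mdist (place t q) (place t' q') <= `|t - t'| + mdist q q'.
Proof.
move=> tI t'I; apply: mdist_le => i.
have t0 := normr_ge0 (t - t'); have q0 := mdist_ge0 q q'.
have le1 (r : R) n : 0 <= r -> r <= 2 ^+ n * r.
  by move=> r0; rewrite ler_peMl// exprn_ege1// ler1n.
case: (nat_place_cases i) => [->|->|[j ->]|[j ->]].
- by rewrite !crd_place0 subrr normr0; nra.
- rewrite !crd_place1// (_ : _ - _ = (t - t') / 4); last by ring.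
  by rewrite normrM (ger0_norm (_ : 0 <= 4^-1))//; lra.
- by rewrite !crd_place_even subrr normr0 mulr_ge0 ?exprn_ge0// addr_ge0.
- rewrite !crd_place_odd (_ : _ - _ = (crd q j - crd q' j) / 2); last by ring.
  rewrite normrM (ger0_norm (_ : 0 <= 2^-1))//.
  have := crd_dist q q' j; have h := le1 _ j.+1.*2.+1 t0.
  have : 2 ^+ j * mdist q q' <= 2 ^+ j.+1.*2.+1 * mdist q q'.
    by rewrite ler_wpM2r// ler_weXn2l// ?ler1n// -addnn; apply/leqW/leq_trans/leq_addr.
  by rewrite mulrDr; have := mulr_ge0 (exprn_ge0 j (ler0n R 2)) q0; lra.
Qed.

Definition unplace x : Q := mkcube (fun j => (crd x j.+1.*2.+1 - 4^-1) * 2).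

Lemma unplaceK t : cancel (place t) unplace.
Proof.
move=> q; apply: crd_inj => j; rewrite crd_mk crd_place_odd.
by rewrite (_ : _ * 2 = crd q j) ?clip_id ?crd_itv//; field.
Qed.

Lemma continuous_unplace : continuous unplace.
Proof.
apply: continuous_mkcube => j; apply: continuous_mulr; last exact: cst_continuous.
by apply: continuous_subr; [exact: continuous_crd|exact: cst_continuous].
Qed.

Lemma continuous_place t : continuous (place t).
Proof.
apply: continuous_mkcube => -[|k]; first exact: cst_continuous.
case: (odd k); first exact: cst_continuous.
case: k./2 => [|j]; first exact: cst_continuous.
apply: continuous_addr; first exact: cst_continuous.
by apply: continuous_mulr; [exact: continuous_crd|exact: cst_continuous].
Qed.

Context (q : nat -> Q).

Definition foot n : Q := place (2 ^+ n)^-1 (q n).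

Lemma pow2V_itv n : 0 <= ((2 ^+ n)^-1 : R) <= 1.
Proof.
by rewrite invr_ge0 exprn_ge0//= invf_le1 ?exprn_gt0// exprn_ege1// ler1n.
Qed.

Lemma foot_raise n : raise 0 (foot n) = foot n. Proof. exact: raise_place. Qed.

Lemma crd_foot1 n : crd (foot n) 1 = 4^-1 + (2 ^+ n)^-1 / 4.
Proof. by rewrite crd_place1// pow2V_itv. Qed.

(** Slabs around the feet, cut out by coordinate 1. They are pairwise disjoint: in this coordinate
    the feet n and n + 1 differ by 2^-n / 8, which exceeds the sum 3 * 2^-n / 32 of the two
    radii. *)
Definition near_foot n x := `|crd (foot n) 1 - crd x 1| < (2 ^+ n)^-1 / 16.

Lemma near_foot_inj n m x : near_foot n x -> near_foot m x -> n = m.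
Proof.
wlog nm : n m / (n < m)%N => [h n0 m0|].
  by case: (ltngtP n m) => // nm; [exact: h|apply/esym/h].
rewrite /near_foot !crd_foot1 !ltr_norml => /andP[n1 n2] /andP[m1 m2]; exfalso.
have : (2 ^+ m)^-1 <= (2 ^+ n.+1)^-1 :> R.
  by rewrite lef_pV2 ?posrE ?exprn_gt0// ler_weXn2l// ler1n.
rewrite exprS invfM; have : 0 < (2 ^+ n)^-1 :> R by rewrite invr_gt0 exprn_gt0.
lra.
Qed.

Lemma near_foot_self n : near_foot n (foot n).
Proof. by rewrite /near_foot subrr normr0 divr_gt0// invr_gt0 exprn_gt0. Qed.

Lemma foot_inj : injective foot.
Proof.
by move=> n m nm; apply: (near_foot_inj (near_foot_self n)); rewrite nm; exact: near_foot_self.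
Qed.

Definition rho n x := mdist (foot n) (raise 0 x).

Lemma continuous_rho n : continuous (rho n).
Proof. by move=> x; apply: continuous_comp; [exact: continuous_raise0|exact: continuous_mdist]. Qed.

Lemma rho_ge0 n x : 0 <= rho n x. Proof. exact: mdist_ge0. Qed.

Lemma rho0 n x : rho n x = 0 -> raise 0 x = foot n.
Proof. by move=> /mdist_positivity. Qed.

(** Coordinate 1 is 2-Lipschitz, so a point whose projection is closer to foot n than 1 / [steep n],
    half the radius of slab n, lies in that slab. *)
Definition steep n : R := 32 * 2 ^+ n.

Lemma steep_near n x : steep n * rho n x < 1 -> near_foot n x.
Proof.
move=> h; rewrite /near_foot -(crd_raiseS 0 x 0).
apply: le_lt_trans (crd_dist _ _ _) _; rewrite expr1 -/(rho n x).
rewrite -ltr_pdivlMl//.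
have p : 0 < 2 ^+ n :> R by rewrite exprn_gt0.
rewrite (_ : _ * _ = (steep n)^-1); first by rewrite -[ltRHS]mulr1 ltr_pdivlMl// mulr_gt0.
by rewrite /steep invfM; field; rewrite gt_eqF.
Qed.

Definition brush (l : nat -> R) : set Q :=
  [set x | crd x 0 = 0 \/ exists n, 0 < crd x 0 <= l n /\ raise 0 x = foot n].

Lemma brush_raise l n s : 0 <= s <= 1 -> s <= l n -> brush l (raise s (foot n)).
Proof.
move=> sI sl; have /andP[s0 _] := sI; move: s0; rewrite le_eqVlt => /predU1P[<-|s0].
  by left; rewrite crd_raise00.
by right; exists n; rewrite crd_raise0// s0 sl raise_raise foot_raise.
Qed.

(** * The retraction of the cube onto a brush *)

Section retraction.
Context (l : nat -> R).
Hypothesis l01 : forall n, 0 <= l n <= 1.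
Hypothesis l_van : vanishing l.

(** How far the retraction may move a point towards hair n. It is the height on the hair itself, 0
    on the base and outside slab n, and at most [l n]. *)
Definition theta n x := Num.max 0 (Num.min (crd x 0) (l n) - steep n * rho n x).

Lemma theta_ge0 n x : 0 <= theta n x. Proof. by rewrite le_max lexx. Qed.

Lemma theta_le n x : theta n x <= l n.
Proof.
have /andP[l0 l1] := l01 n; rewrite ge_max l0 /= lerBlDr ge_min.
by apply/orP; right; rewrite lerDl mulr_ge0 ?rho_ge0// mulr_ge0 ?exprn_ge0.
Qed.

Lemma theta_near n x : 0 < theta n x -> near_foot n x.
Proof.
rewrite lt_max ltxx /= subr_gt0 => h; apply: steep_near; apply: (lt_le_trans h).
by rewrite ge_min crd_le1.
Qed.

Lemma continuous_theta n : continuous (theta n).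
Proof.
apply: continuous_maxr; first exact: cst_continuous.
apply: continuous_subr.
  by apply: continuous_minr; [exact: continuous_crd|exact: cst_continuous].
by apply: continuous_mulr; [exact: cst_continuous|exact: continuous_rho].
Qed.

(** The height becomes the excess of [theta] over [rho], and coordinate i moves towards that of the
    foot by at most 2^i * [theta]. If [rho < theta], each coordinate is within that bound of the
    foot, so the point lands exactly above the foot; otherwise the height becomes 0 and the point
    lands in the base. Either way the image is in the brush. *)
Definition shift i n x : R :=
  if i is _.+1 then
    - Num.max (- (2 ^+ i * theta n x)) (Num.min (2 ^+ i * theta n x) (crd x i - crd (foot n) i))
  else Num.max 0 (theta n x - rho n x).

Lemma shift_le i n x : `|shift i n x| <= 2 ^+ i * l n.
Proof.
have t0 := theta_ge0 n x; have tl := theta_le n x; have r0 := rho_ge0 n x.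
have h : 0 <= 2 ^+ i * theta n x <= 2 ^+ i * l n.
  by rewrite mulr_ge0 ?exprn_ge0//= ler_wpM2l// exprn_ge0.
case: i h => [|i] /andP[h0 h1]; rewrite /shift.
  rewrite expr0 !mul1r in h1 *; rewrite ger0_norm ?le_max ?lexx// ge_max.
  by apply/andP; split; lra.
rewrite normrN; apply: le_trans h1; rewrite ler_norml le_max lexx /= ge_max.
by rewrite ge_min lexx andbT; lra.
Qed.

Lemma shift0 i n x : theta n x = 0 -> shift i n x = 0.
Proof.
have r0 := rho_ge0 n x; rewrite /shift => ->; case: i => [|i].
  by apply/max_idPl; rewrite sub0r oppr_le0.
by rewrite mulr0 oppr0; apply/eqP; rewrite oppr_eq0; apply/eqP/max_idPl; rewrite ge_min lexx.
Qed.

Lemma continuous_shift i n : continuous (shift i n).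
Proof.
have ct : continuous (theta n) by exact: continuous_theta.
case: i => [|i]; rewrite /shift.
  apply: continuous_maxr; first exact: cst_continuous.
  by apply: continuous_subr; last exact: continuous_rho.
have c2 : continuous (fun x => 2 ^+ i.+1 * theta n x).
  by apply: continuous_mulr => //; exact: cst_continuous.
have cN (f : Q -> R) : continuous f -> continuous (fun x => - f x).
  move=> cf; under eq_fun do rewrite -sub0r.
  by apply: continuous_subr => //; exact: cst_continuous.
apply: (cN); apply: continuous_maxr; first by apply: (cN).
apply: continuous_minr => //; apply: continuous_subr; last exact: cst_continuous.
exact: continuous_crd.
Qed.

(** The slabs are disjoint, so at most one [theta n x] is positive. If none is, the default 0 is
    harmless because all shifts vanish. *)
Definition active x : nat := xget 0%N [set n | 0 < theta n x].

Lemma theta_inactive n x : n <> active x -> theta n x = 0.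
Proof.
move=> nA; apply/eqP; rewrite eq_le theta_ge0 andbT leNgt; apply/negP => n0; apply: nA.
have /= a0 : [set n | 0 < theta n x] (active x) by apply: xgetPex; exists n.
by apply: (@near_foot_inj _ _ x); exact: theta_near.
Qed.

Definition retraction x : Q := mkcube (fun i =>
  (if i is _.+1 then crd x i else 0) + shift i (active x) x).

(** In a fixed coordinate i the shifts are bounded by 2^i * [l n], which tends to 0 with n; here the
    lengths of the hairs have to tend to 0. *)
Lemma continuous_retraction : continuous retraction.
Proof.
apply: continuous_mkcube => i; apply: continuous_addr.
  by case: i => [|i]; [exact: cst_continuous|exact: continuous_crd].
apply: (continuous_selected (a := fun n => 2 ^+ i * l n)).
- by move=> n; exact: continuous_shift.
- by move=> n x /theta_inactive; exact: shift0.
- by move=> n x; exact: shift_le.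
- move=> e e0; have [|M lM] := l_van (_ : 0 < e / 2 ^+ i); first by rewrite divr_gt0// exprn_gt0.
  by exists M => n /lM; rewrite ltr_pdivlMr ?exprn_gt0// mulrC.
Qed.

Lemma retraction_brush x : brush l (retraction x).
Proof.
have [n0|] := boolP (crd (retraction x) 0 == 0); first by left; exact/eqP.
set n := active x; have r0 := rho_ge0 n x; have /andP[_ l1] := l01 n; have tl := theta_le n x => h.
have e0 : crd (retraction x) 0 = shift 0 n x.
  rewrite crd_mk add0r clip_id// /shift le_max lexx /= ge_max ler01 /=.
  by rewrite lerBlDr; lra.
have rt : rho n x < theta n x.
  by rewrite ltNge; apply/negP => tr; move: h; rewrite e0 /shift max_l ?subr_le0// eqxx.
have rt' : 0 <= theta n x - rho n x by rewrite subr_ge0 ltW.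
right; exists n; rewrite e0 /shift (max_r rt'); split.
  by rewrite subr_gt0 rt /=; lra.
apply: crd_inj => -[|i]; first by rewrite crd_raise00 crd_place0.
rewrite crd_raiseS crd_mk -/n /shift.
have := crd_dist (foot n) (raise 0 x) i.+1; rewrite crd_raiseS -/(rho n x) => d.
have {}d : `|crd (foot n) i.+1 - crd x i.+1| <= 2 ^+ i.+1 * theta n x.
  by apply: le_trans d _; rewrite ler_wpM2l ?exprn_ge0// ltW.
move: d; rewrite ler_norml => /andP[d1 d2].
rewrite min_r; last lra.
by rewrite max_r; [rewrite opprB addrC subrK clip_id// crd_itv|lra].
Qed.

Lemma retraction_id x : brush l x -> retraction x = x.
Proof.
have tx0 : crd x 0 = 0 -> retraction x = x.
  move=> x0; have t0 n : theta n x = 0.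
    apply: max_l; rewrite x0; have /andP[l0 _] := l01 n; rewrite min_l// sub0r oppr_le0.
    by rewrite mulr_ge0 ?rho_ge0// mulr_ge0 ?exprn_ge0.
  apply: crd_inj => i; rewrite crd_mk shift0// addr0.
  by case: i => [|i]; rewrite clip_id ?crd_itv// lexx ler01.
move=> [/tx0//|[n [/andP[x0 xl] xn]]].
have rho_n : rho n x = 0 by rewrite /rho xn mdistxx.
have th : theta n x = crd x 0.
  by rewrite /theta rho_n mulr0 subr0 (min_l xl) max_r// ltW.
have an : active x = n.
  have [//|/eqP na] := eqVneq (active x) n.
  by have := theta_inactive (nesym na); rewrite th => /eqP; rewrite gt_eqF.
apply: crd_inj => i; rewrite crd_mk an /shift th rho_n; case: i => [|i].
  by rewrite subr0 add0r max_r ?clip_id ?crd_itv// ltW.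
rewrite -xn crd_raiseS subrr min_r ?max_r ?oppr0 ?addr0 ?clip_id ?crd_itv//.
  by rewrite oppr_le0 mulr_ge0 ?exprn_ge0// ltW.
by rewrite mulr_ge0 ?exprn_ge0// ltW.
Qed.

Lemma brush_compact : compact (brush l).
Proof.
have -> : brush l = retraction @` setT.
  apply/seteqP; split => [x xB|_ [x _ <-]]; last exact: retraction_brush.
  by exists x => //; exact: retraction_id.
by apply: continuous_compact cube_compact; apply: continuous_subspaceT; exact: continuous_retraction.
Qed.

Lemma brush_retract : is_retract (brush l).
Proof.
exists (fun x => exist _ (retraction x) (mem_set (retraction_brush x))); split.
  apply: continuous_comp_initial; rewrite (_ : _ \o _ = retraction).
    exact: continuous_retraction.
  by apply/funext => x /=; rewrite set_valE.
move=> [a aB]; apply: val_inj; rewrite /= set_valE /= retraction_id//; exact: set_mem.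
Qed.
End retraction.
End brush.

(** * Cut points of a brush *)

Section subtypes.
Context {X : topologicalType} {A : set X}.

Definition insubset x (Ax : A x) : set_type A := exist _ x (mem_set Ax).

Lemma val_insubset x (Ax : A x) : set_val (insubset Ax) = x.
Proof. by rewrite set_valE. Qed.

Lemma set_val_in (z : set_type A) : A (set_val z).
Proof. by rewrite set_valE; case: z => x /= /set_mem. Qed.

Lemma set_val_inj : injective (set_val : set_type A -> X).
Proof. by move=> z w; rewrite set_valE; exact: val_inj. Qed.

Lemma continuous_set_val : continuous (set_val : set_type A -> X).
Proof. exact: initial_continuous. Qed.

Lemma continuous_insubset (T : topologicalType) (f : T -> X) (fA : forall t, A (f t)) :
  continuous f -> continuous (fun t => insubset (fA t)).
Proof.
by move=> cf; apply: continuous_comp_initial; rewrite (_ : _ \o _ = f).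
Qed.
End subtypes.

Definition cut_point (T : topologicalType) (x : T) := ~ connected [set y | y <> x].

(** The topological property that singles out the copy of the compactum. Limits of cut points alone
    would include the tips of the hairs; the second clause excludes them, since near a tip all other
    points are cut points. *)
Definition cut_limit (T : topologicalType) (x : T) := ~ cut_point x /\
  forall U, nbhs x U -> (exists2 y, U y & cut_point y) /\
    (exists2 y, U y & y <> x /\ ~ cut_point y).

Section invariance.
Context {S T : topologicalType} (f : S -> T) (g : T -> S).
Hypotheses (fK : cancel f g) (gK : cancel g f) (cg : continuous g).

Lemma cut_point_homeo x : cut_point x -> cut_point (f x).
Proof.
apply: contra_not => cT.
rewrite (_ : mkset _ = g @` [set y | y <> f x]).
  by apply: connected_continuous_connected => //; exact: continuous_subspaceT.
apply/seteqP; split => [y yx|_ [y yx <-] gx]; last by apply: yx; rewrite -gx gK.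
by exists (f y); rewrite /= ?fK// => /(can_inj fK).
Qed.
End invariance.

Lemma cut_limit_homeo (S T : topologicalType) (f : S -> T) (g : T -> S) x :
  cancel f g -> cancel g f -> continuous f -> continuous g ->
  cut_limit x -> cut_limit (f x).
Proof.
move=> fK gK cf cg [nx xU]; split => [/(cut_point_homeo gK fK cf)|U /cf/xU]; first by rewrite fK.
move=> [[y Uy cy] [z Uz [zx nz]]]; split; first by exists (f y) => //; exact: (cut_point_homeo fK gK cg).
exists (f z) => //; split => [/(can_inj fK)//|/(cut_point_homeo gK fK cf)].
by rewrite fK.
Qed.

(** Of the points [d n], only the finitely many with [a n] at least e / 2 can come within e / 2 of a
    point that has distance e from [C]. *)
Lemma closedU_vanishing (R : realType) (M : metricType R) (C : set M) (A : set nat)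
    (c d : nat -> M) (a : nat -> R) :
  closed C -> (forall n, A n -> C (c n)) -> (forall n, A n -> mdist (d n) (c n) <= a n) ->
  vanishing a -> closed (C `|` d @` A).
Proof.
move=> Ccl Cc dca a0 x Ex; apply: contrapT => /not_orP[nCx ndx].
have [e e0 Ce] : exists2 e, 0 < e & forall y, C y -> e <= mdist x y.
  have : nbhs x (~` C) by apply: open_nbhs_nbhs; split => //; exact: closed_openC.
  move=> /metricType_numDomainType.nbhs_mdistP[e /= e0 eC]; exists e => // y Cy.
  by rewrite leNgt; apply/negP => /eC.
have e2 : 0 < e / 2 by rewrite divr_gt0.
have [N aN] := a0 _ e2.
have nd (i : 'I_N) : \forall y \near x, A i -> y <> d i.
  have [Ai|nAi] := pselect (A i); last by near=> y.
  have di : 0 < mdist x (d i).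
    rewrite lt_neqAle mdist_ge0 andbT; apply/eqP => /esym/mdist_positivity xd.
    by apply: ndx; exists (i : nat).
  by apply: filterS (near_mdist x di) => y + _ yd; rewrite yd ltxx.
have /Ex [y [[Cy|[n An <-]] [xy yd]]] :
    nbhs x [set y | mdist x y < e / 2 /\ forall i : 'I_N, A i -> y <> d i].
  by apply: filterI; [exact: near_mdist|exact: filter_forall].
- by have := Ce _ Cy; lra.
- have [nN|Nn] := ltnP n N; first exact: (yd (Ordinal nN)).
  have := Ce _ (Cc _ An); have := aN _ Nn; have := dca _ An.
  by have := metric_triangle x (d n) (c n); lra.
Unshelve. all: by end_near. Qed.

(** * The points of a hair below its tip are cut points *)

Section hairs.
Context {R : realType}.
Local Notation Q := (hilbert_cube R).
Context (q : nat -> Q) (l : nat -> R).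
Hypothesis l01 : forall n, 0 <= l n <= 1.

Local Notation B := (brush q l).
Local Notation T := (set_type B).
Local Notation foot := (foot q).
Local Notation rho := (rho q).

(** A continuous weight that is 1 above foot n and 0 above every other foot. *)
Definition tent n (x : Q) : R := Num.max 0 (1 - steep n * rho n x).

Lemma continuous_tent n : continuous (tent n).
Proof.
apply: continuous_maxr; first exact: cst_continuous.
apply: continuous_subr; first exact: cst_continuous.
by apply: continuous_mulr; [exact: cst_continuous|exact: continuous_rho].
Qed.

Lemma tent1 n x : raise 0 x = foot n -> tent n x = 1.
Proof. by move=> xn; rewrite /tent /rho xn mdistxx mulr0 subr0 max_r// ler01. Qed.

Lemma tent0 n m x : n <> m -> raise 0 x = foot m -> tent n x = 0.
Proof.
move=> nm xm; apply: max_l; rewrite leNgt; apply/negP; rewrite subr_gt0 => /steep_near h.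
apply: nm; apply: near_foot_inj h _; rewrite /near_foot -(crd_raiseS 0 x 0) xm.
exact: near_foot_self.
Qed.

(* On the brush, hair [n] is where this function is nonnegative, and there it
   is the height. *)
Definition along n (x : Q) : R := crd x 0 * tent n x - rho n x.

Lemma continuous_along n : continuous (along n).
Proof.
apply: continuous_subr; last exact: continuous_rho.
by apply: continuous_mulr; [exact: continuous_crd|exact: continuous_tent].
Qed.

Lemma along_hair n x : raise 0 x = foot n -> along n x = crd x 0.
Proof. by move=> xn; rewrite /along tent1// /rho xn mdistxx subr0 mulr1. Qed.

Lemma along_ge0 n x : B x -> 0 <= along n x -> raise 0 x = foot n.
Proof.
move=> Bx; have [x0|[m [/andP[x0 xm] xf]]] := Bx; rewrite /along.
  rewrite x0 mul0r sub0r oppr_ge0 => r0; apply: rho0.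
  by apply/eqP; rewrite eq_le r0 rho_ge0.
have [<-//|/eqP nm] := eqVneq m n.
rewrite (tent0 (nesym nm) xf) mulr0 sub0r oppr_ge0 => r0; apply: rho0.
by apply/eqP; rewrite eq_le r0 rho_ge0.
Qed.

Lemma brush_le n x : B x -> raise 0 x = foot n -> crd x 0 <= l n.
Proof.
have /andP[l0 _] := l01 n.
by move=> [->//|[m [/andP[_ xm] ->]]] /foot_inj <-.
Qed.

(** On the brush, [along n] takes its value at [z] only there, but it is negative at the next foot
    and larger at the tip. Were the complement of [z] connected, the intermediate values would
    include that at [z]. The foot of a nondegenerate hair is covered too. *)
Lemma hair_cut n (z : T) :
  raise 0 (set_val z) = foot n -> crd (set_val z) 0 < l n -> cut_point z.
Proof.
move=> zn zl conn; have ca : continuous (fun w : T => along n (set_val w)).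
  by move=> w; apply: continuous_comp; [exact: continuous_set_val|exact: continuous_along].
have /connected_intervalP itv := connected_continuous_connected conn (continuous_subspaceT ca).
have z0 := crd_ge0 (set_val z) 0.
have Bt : B (raise (l n) (foot n)) by exact: brush_raise.
have Bd : B (foot n.+1) by left; exact: crd_place0.
have av := along_hair zn.
have [w wz aw] : [set along n (set_val w) | w in [set w : T | w <> z]] (along n (set_val z)).
  apply: (itv (along n (foot n.+1)) (l n)).
  - exists (insubset Bd); rewrite ?val_insubset//= => zd; move: zn.
    by rewrite -zd val_insubset foot_raise => /foot_inj/esym/n_Sn.
  - exists (insubset Bt); rewrite ?val_insubset ?along_hair ?crd_raise0 ?raise_raise ?foot_raise//=.
    by move=> zd; move: zl; rewrite -zd val_insubset crd_raise0// ltxx.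
  - rewrite av (ltW zl) andbT (le_trans _ z0)// leNgt; apply/negP => h.
    by have := along_ge0 Bd (ltW h); rewrite foot_raise => /foot_inj/esym/n_Sn.
apply: wz; apply: set_val_inj.
have wn : raise 0 (set_val w) = foot n by apply: along_ge0; [exact: set_val_in|rewrite aw av].
rewrite -(raise_id (set_val w)) -(raise_id (set_val z)).
rewrite -(raise_raise _ 0 (set_val w)) -(raise_raise _ 0 (set_val z)) wn zn.
by rewrite -av -aw along_hair.
Qed.
End hairs.

Lemma connected_path (R : realType) (X : topologicalType) (A : set X) (g : R -> X) :
  continuous g -> (forall t, 0 <= t <= 1 -> A (g t)) ->
  connected [set z : set_type A | exists2 t, 0 <= t <= 1 & g t = set_val z].
Proof.
move=> cg gA; have gA' t : A (g (clip t)).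
  by apply: gA; have := set_mem (clip_itv t); rewrite /= in_itv.
have cg' : continuous (fun t => insubset (gA' t)).
  apply: continuous_insubset => t; apply: continuous_comp; last exact: cg.
  by apply: continuous_clip => ?; exact: cvg_id.
rewrite (_ : mkset _ = (fun t => insubset (gA' t)) @` `[0, 1]).
  apply: connected_continuous_connected; first exact: segment_connected.
  exact: continuous_subspaceT.
apply/seteqP; split => [z [t t01 tz]|_ [t t01 <-]].
  exists t; first by rewrite /= in_itv.
  by apply: set_val_inj; rewrite val_insubset clip_id.
exists t; first by move: t01; rewrite /= in_itv.
by rewrite val_insubset clip_id//; move: t01; rewrite /= in_itv.
Qed.

Definition joined (T : topologicalType) (A : set T) (x y : T) :=
  exists C : set T, [/\ connected C, C `<=` A, C x & C y].

Lemma joined_trans (T : topologicalType) (A : set T) y x z :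
  joined A x y -> joined A y z -> joined A x z.
Proof.
move=> [C [cC CA Cx Cy]] [D [cD DA Dy Dz]]; exists (C `|` D); split; [|by move=> w []; auto|by left|by right].
by apply: connectedU => //; exists y.
Qed.

Lemma joined_connected (T : topologicalType) (A : set T) x :
  A x -> (forall y, A y -> joined A x y) -> connected A.
Proof.
move=> Ax xA; rewrite (_ : A = \bigcup_(C in [set C | [/\ connected C, C `<=` A & C x]]) C).
  by apply: bigcup_connected => [|C []//]; exists x => C [].
apply/seteqP; split => [y /xA[C [cC CA Cx Cy]]|y [C [_ CA _] /CA//]]; by exists C.
Qed.

(** * Recovering the compactum from its brush *)

Section recovery.
Context {R : realType}.
Local Notation Q := (hilbert_cube R).
Context (q : nat -> Q) (l : nat -> R).
Hypothesis l01 : forall n, 0 <= l n <= 1.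

Local Notation B := (brush q l).
Local Notation T := (set_type B).
Local Notation foot := (foot q).

Lemma path_joined (A : set T) (g : R -> Q) (x y : T) :
  continuous g -> (forall t, 0 <= t <= 1 -> B (g t)) ->
  (forall z : T, (exists2 t, 0 <= t <= 1 & g t = set_val z) -> A z) ->
  g 0 = set_val x -> g 1 = set_val y -> joined A x y.
Proof.
move=> cg gB gA g0 g1; exists [set z : T | exists2 t, 0 <= t <= 1 & g t = set_val z].
by split => //; [exact: connected_path|exists 0|exists 1]; rewrite ?lexx ?ler01.
Qed.

Lemma continuous_segment (a b : R) : continuous (fun t : R => (1 - t) * a + t * b).
Proof.
apply: continuous_addr; apply: continuous_mulr; try exact: cst_continuous.
  by apply: continuous_subr; [exact: cst_continuous|move=> ?; exact: cvg_id].
by move=> ?; exact: cvg_id.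
Qed.

Lemma segment_itv (a b t : R) : 0 <= a <= 1 -> 0 <= b <= 1 -> 0 <= t <= 1 ->
  0 <= (1 - t) * a + t * b <= 1.
Proof. by move=> /andP[? ?] /andP[? ?] /andP[? ?]; apply/andP; split; nra. Qed.

(** A point of the base can be bypassed by changing coordinates in two stages: every other point of
    the base is joined to a fixed [p] by two segments that avoid [x]. A point on a hair first slides
    down to its foot, which is not [x]. *)
Lemma base_noncut (x : T) : crd (set_val x) 0 = 0 ->
  (forall n, 0 < l n -> set_val x <> foot n) -> ~ cut_point x.
Proof.
move=> x0 xf; apply; pose A := [set y : T | y <> x]; rewrite -/A.
(* Every positive coordinate of [p] differs from that of [x]. *)
pose p : Q := mkcube (fun i => if i is _.+1 then if crd (set_val x) i == 0 then 1 else 0 else 0).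
have p01 i : crd p i = if i is _.+1 then if crd (set_val x) i == 0 then 1 else 0 else 0.
  by rewrite crd_mk_id//; case: i => [|i]; [|case: ifP]; rewrite ?lexx ?ler01.
have px i : crd p i.+1 <> crd (set_val x) i.+1.
  by rewrite p01; case: ifPn => [/eqP->|xi]; apply/eqP; rewrite ?oner_eq0// eq_sym.
have Bp : B p by left; rewrite p01.
have neq (z : T) i : crd (set_val z) i <> crd (set_val x) i -> A z by move=> + zx; rewrite zx.
apply: (@joined_connected _ _ (insubset Bp)).
  by apply: (neq _ 1%N); rewrite val_insubset.
have base (b : T) : A b -> crd (set_val b) 0 = 0 -> joined A b (insubset Bp).
  move=> Ab b0.
  have [i bi] : exists i, crd (set_val b) i <> crd (set_val x) i.
    by apply: contrapT => /forallNP h; apply: Ab; apply/set_val_inj/crd_inj => i; apply: contrapT; exact: h.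
  have [k [k0 ki]] : exists k, (0 < k)%N /\ (k != i).
    by exists (if i == 1%N then 2%N else 1%N); case: i bi => [|[|i]].
  (* The segment from [b] to [m] keeps coordinate [i], where [b] differs from [x]; the one from [m]
     to [p] keeps coordinate [k], where [p] differs from [x]. *)
  pose m : Q := mkcube (fun j => if j == i then crd (set_val b) j else crd p j).
  have mE j : crd m j = if j == i then crd (set_val b) j else crd p j.
    by rewrite crd_mk_id//; case: ifP; rewrite crd_itv.
  have Bm : B m by left; rewrite mE; case: ifP; rewrite ?p01.
  pose seg (y z : Q) (t : R) : Q := mkcube (fun j => (1 - t) * crd y j + t * crd z j).
  have segE y z t j : 0 <= t <= 1 -> crd (seg y z t) j = (1 - t) * crd y j + t * crd z j.
    by move=> t01; rewrite crd_mk_id// segment_itv ?crd_itv.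
  have seg0 y z : seg y z 0 = y.
    by apply: crd_inj => j; rewrite segE ?lexx ?ler01// subr0 mul1r mul0r addr0.
  have seg1 y z : seg y z 1 = z.
    by apply: crd_inj => j; rewrite segE ?lexx ?ler01// subrr mul1r mul0r add0r.
  have cseg y z : continuous (seg y z).
    by apply: continuous_mkcube => j; exact: continuous_segment.
  have Bseg y z t : crd y 0 = 0 -> crd z 0 = 0 -> 0 <= t <= 1 -> B (seg y z t).
    by move=> y0 z0 t01; left; rewrite segE// y0 z0 !mulr0 addr0.
  have m0 : crd m 0 = 0 by rewrite mE; case: ifP; rewrite ?p01.
  have p0 : crd p 0 = 0 by rewrite p01.
  apply: (@joined_trans _ _ (insubset Bm)).
    apply: (path_joined (g := seg (set_val b) m)); rewrite ?seg0 ?seg1 ?val_insubset//.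
      by move=> t; exact: Bseg.
    move=> z [t t01 tz]; apply: (neq _ i); rewrite -tz segE// mE eqxx -mulrDl subrK mul1r//.
  apply: (path_joined (g := seg m p)); rewrite ?seg0 ?seg1 ?val_insubset//.
    by move=> t; exact: Bseg.
  move=> z [t t01 tz]; apply: (neq _ k); rewrite -tz segE// mE (negbTE ki) -mulrDl subrK mul1r.
  by case: k k0 {ki} => // k _; exact: px.
have jsym (y z : T) : joined A y z -> joined A z y by move=> [C []]; exists C; split.
move=> y Ay; apply: (jsym); have [y0|[n [/andP[y0 yl] yn]]] := set_val_in y; first exact: base.
have By : B (raise 0 (set_val y)) by left; rewrite crd_raise00.
have fx : foot n <> set_val x by move=> /esym; apply: xf; exact: lt_le_trans yl.
apply: (@joined_trans _ _ (insubset By)); last first.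
  apply: base; last by rewrite val_insubset crd_raise00.
  by move=> yx; apply: fx; rewrite -yx val_insubset.
apply: (jsym); apply: (path_joined (g := fun t => raise (t * crd (set_val y) 0) (set_val y))).
- apply: continuous_mkcube => -[|j]; last exact: cst_continuous.
  by apply: continuous_mulr; [move=> ?; exact: cvg_id|exact: cst_continuous].
- move=> t /andP[t0 t1]; rewrite -(raise_raise _ 0) yn.
  have /andP[? ?] := crd_itv (set_val y) 0.
  by apply: brush_raise; [apply/andP; split|]; nra.
- move=> z [t _ tz] zx; apply: fx.
  by rewrite -yn -(raise_raise 0 (t * crd (set_val y) 0)) tz zx -x0 raise_id.
- by rewrite mul0r val_insubset.
- by rewrite mul1r raise_id.
Qed.

Lemma place_neq_foot (k : Q) n : place 0 k <> foot n.
Proof.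
move=> /(congr1 (fun x : Q => crd x 1)).
rewrite crd_foot1 crd_place1 ?lexx ?ler01// mul0r => /addrI/esym/eqP.
by rewrite mulf_eq0 !invr_eq0 !gt_eqF// exprn_gt0.
Qed.

Context (K : set Q).
Hypothesis E_closed : closed (place 0 @` K `|` foot @` [set n | 0 < l n]).
Hypothesis E_dense : forall k e, K k -> 0 < e ->
  exists n, 0 < l n /\ mdist (place 0 k) (foot n) < e.

(** Each point of the copy is approached by feet of nondegenerate hairs, which are cut points, and
    by points of the base off the feet, which are not. Conversely, a base point outside the closed
    set of placed points and feet is no limit of cut points, a foot or inner point of a hair is a
    cut point, and a tip has only cut points around it. *)
Lemma cut_limitP (x : T) : cut_limit x <-> exists2 k, K k & set_val x = place 0 k.
Proof.
split=> [[nx xU]|[k Kk xk]]; last first.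
  split.
    by apply: base_noncut => [|n _]; rewrite xk ?crd_place0//; exact: place_neq_foot.
  move=> U [V [[W oW <-] /= Wx] WU].
  have /metricType_numDomainType.nbhs_mdistP[e /= e0 eW] : nbhs (set_val x) W.
    exact: open_nbhs_nbhs.
  split.
    have [n [ln xn]] := E_dense Kk e0.
    have Bn : B (foot n) by left; exact: crd_place0.
    exists (insubset Bn); first by apply/WU/eW; rewrite /= val_insubset xk.
    by apply: (hair_cut l01 (n := n)) => //; rewrite val_insubset ?foot_raise ?crd_place0.
  have [N /(_ N (leqnn N)) Ne] := pow2V_lt e0.
  (* All placed points, feet included, have 1/2 in the positive even coordinates. Changing
     coordinate 2N + 2 to 0 therefore leaves the copy and the feet, and moves the point by at most
     2^-N. *)
  pose y : Q := mkcube (fun i => if i == N.*2.+2 then 0 else crd (place 0 k) i).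
  have yE i : crd y i = if i == N.*2.+2 then 0 else crd (place 0 k) i.
    by rewrite crd_mk_id//; case: ifP; rewrite ?lexx ?ler01 ?crd_itv.
  have By : B y by left; rewrite yE crd_place0.
  have neq z : crd z N.*2.+2 = 2^-1 -> y <> z.
    by move=> + yz; rewrite -yz yE eqxx => /esym/eqP; rewrite invr_eq0 pnatr_eq0.
  exists (insubset By); last split.
  - apply/WU/eW; rewrite /= val_insubset xk; apply: le_lt_trans Ne.
    apply: mdist_le => i; rewrite yE; case: eqP => [->|_].
      rewrite subr0 crd_place_even ger0_norm// (@le_trans _ _ 1)//; first lra.
      rewrite ler_pdivlMr ?exprn_gt0// mul1r ler_weXn2l// ?ler1n//.
      by rewrite -addnn; apply/leqW/leqW/leq_addr.
    by rewrite subrr normr0 mulr_ge0 ?invr_ge0 ?exprn_ge0.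
  - by move=> /(congr1 set_val); rewrite val_insubset xk; apply: neq; exact: crd_place_even.
  - apply: base_noncut => [|n _]; rewrite val_insubset; first by rewrite yE crd_place0.
    by apply: neq; exact: crd_place_even.
have [x0|[n [/andP[x0 xl] xn]]] := set_val_in x.
  have rx : raise 0 (set_val x) = set_val x by rewrite -x0 raise_id.
  have xf n : 0 < l n -> set_val x <> foot n.
    by move=> ln xn; apply: nx; apply: (hair_cut l01 (n := n)) => //; rewrite ?rx// x0.
  apply: contrapT => nk.
  have nE : (~` (place 0 @` K `|` foot @` [set n | 0 < l n])) (set_val x).
    by move=> [[k Kk kx]|[n ln /esym/xf]]; [apply: nk; exists k|exact].
  (* Nearby points project outside the closed set, so they lie on no hair and are no foot of one. *)
  have [|[y /= nEy cy] _] := xU [set y : T |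
      (~` (place 0 @` K `|` foot @` [set n | 0 < l n])) (raise 0 (set_val y))].
    have cr : continuous (fun y : T => raise 0 (set_val y)).
      by move=> y; apply: continuous_comp; [exact: continuous_set_val|exact: continuous_raise0].
    by apply: cr; rewrite rx; apply: open_nbhs_nbhs; split => //; exact: closed_openC.
  have [y0|[n [/andP[y0 yl] yn]]] := set_val_in y; last first.
    by apply: nEy; right; exists n => //=; exact: lt_le_trans yl.
  apply: (base_noncut y0) cy => n ln yn; apply: nEy; right; exists n => //.
  by rewrite yn foot_raise.
have [xlt|] := ltP (crd (set_val x) 0) (l n); first by case: nx; exact: (hair_cut l01 xn).
move=> lx; have {lx xl}xl : crd (set_val x) 0 = l n by apply/eqP; rewrite eq_le xl.
(* At the tip [along q n] is positive, so all nearby points belong to hair [n] and, apart from the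
   tip, lie below it. *)
have ca : continuous (fun y : T => along q n (set_val y)).
  by move=> y; apply: continuous_comp; [exact: continuous_set_val|exact: continuous_along].
have [|_ [y /= ay [yx ny]]] := xU [set y : T | 0 < along q n (set_val y)].
  have : nbhs (along q n (set_val x)) [set r | 0 < r].
    by apply: open_nbhs_nbhs; split; [exact: open_gt|rewrite /= along_hair].
  exact: ca.
have yn : raise 0 (set_val y) = foot n by apply: along_ge0; [exact: set_val_in|exact: ltW].
exfalso; apply: ny; apply: (hair_cut l01 yn).
rewrite lt_neqAle (brush_le l01 (set_val_in y))// andbT; apply/eqP => yl; apply: yx.
apply: set_val_inj; rewrite -(raise_id (set_val y)) -(raise_id (set_val x)) yl xl.
by rewrite -(raise_raise _ 0 (set_val y)) -(raise_raise _ 0 (set_val x)) yn xn.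
Qed.
End recovery.

(** By [cut_limitP] and the invariance of [cut_limit], a homeomorphism of the brushes and its
    inverse exchange the copies of [K] and [L]; [place 0] and [unplace] carry it over to [K] and
    [L]. *)
Lemma brush_recover (R : realType) (q : nat -> hilbert_cube R) (l m : nat -> R)
    (K L : set (hilbert_cube R)) :
  (forall n, 0 <= l n <= 1) -> (forall n, 0 <= m n <= 1) ->
  closed (place 0 @` K `|` foot q @` [set n | 0 < l n]) ->
  closed (place 0 @` L `|` foot q @` [set n | 0 < m n]) ->
  (forall k e, K k -> 0 < e -> exists n, 0 < l n /\ mdist (place 0 k) (foot q n) < e) ->
  (forall k e, L k -> 0 < e -> exists n, 0 < m n /\ mdist (place 0 k) (foot q n) < e) ->
  homeomorphic (set_type (brush q l)) (set_type (brush q m)) ->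
  homeomorphic (set_type K) (set_type L).
Proof.
have pB (l' : nat -> R) k : brush q l' (place 0 k) by left; exact: crd_place0.
pose t (l' m' : nat -> R) (f : set_type (brush q l') -> set_type (brush q m')) k :=
  set_val (f (insubset (pB l' k))).
have tP l' m' K' L' f g : (forall n, 0 <= l' n <= 1) -> (forall n, 0 <= m' n <= 1) ->
    closed (place 0 @` K' `|` foot q @` [set n | 0 < l' n]) ->
    closed (place 0 @` L' `|` foot q @` [set n | 0 < m' n]) ->
    (forall k e, K' k -> 0 < e -> exists n, 0 < l' n /\ mdist (place 0 k) (foot q n) < e) ->
    (forall k e, L' k -> 0 < e -> exists n, 0 < m' n /\ mdist (place 0 k) (foot q n) < e) ->
    cancel f g -> cancel g f -> continuous f -> continuous g ->
    forall k, K' k -> exists2 k', L' k' & t l' m' f k = place 0 k'.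
  move=> l01 m01 Kc Lc Kd Ld fK gK cf cg k Kk; apply/(cut_limitP m01 Lc Ld).
  apply: (cut_limit_homeo fK gK cf cg); apply/(cut_limitP l01 Kc Kd).
  by exists k => //; rewrite val_insubset.
move=> l01 m01 Kc Lc Kd Ld [f [g [fK gK cf cg]]].
have {}tf := tP _ _ _ _ _ _ l01 m01 Kc Lc Kd Ld fK gK cf cg.
have {}tg := tP _ _ _ _ _ _ m01 l01 Lc Kc Ld Kd gK fK cg cf.
have fL (k : set_type K) : L (unplace (t _ _ f (set_val k))).
  by have [k' Lk' ->] := tf _ (set_val_in k); rewrite unplaceK.
have gK' (k : set_type L) : K (unplace (t _ _ g (set_val k))).
  by have [k' Kk' ->] := tg _ (set_val_in k); rewrite unplaceK.
have ct l' m' A (h : set_type (brush q l') -> set_type (brush q m')) : continuous h ->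
    continuous (fun k : set_type A => unplace (t _ _ h (set_val k))).
  move=> ch; have ci : continuous (fun k : set_type A => insubset (pB l' (set_val k))).
    apply: continuous_insubset => k; apply: continuous_comp; first exact: continuous_set_val.
    exact: continuous_place.
  have chi : continuous (fun k : set_type A => set_val (h (insubset (pB l' (set_val k))))).
    move=> k; apply: (@continuous_comp _ _ _ (fun k => h (insubset (pB l' (set_val k)))) set_val).
      apply: (@continuous_comp _ _ _ (fun k : set_type A => insubset (pB l' (set_val k))) h).
        exact: ci.
      exact: ch.
    exact: continuous_set_val.
  move=> k; apply: (@continuous_comp _ _ _ (fun k : set_type A => t _ _ h (set_val k)) unplace).
    exact: chi.
  exact: continuous_unplace.
have tK l' m' (h : set_type (brush q l') -> set_type (brush q m')) h' (A C : set (hilbert_cube R))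
    (k : set_type A) : cancel h h' ->
    (exists2 k', C k' & t _ _ h (set_val k) = place 0 k') ->
    unplace (t _ _ h' (unplace (t _ _ h (set_val k)))) = set_val k.
  move=> hK [k' _ hk]; rewrite hk unplaceK /t.
  rewrite (_ : insubset (pB m' k') = h (insubset (pB l' (set_val k)))).
    by rewrite hK val_insubset unplaceK.
  by apply: set_val_inj; rewrite val_insubset.
exists (fun k => insubset (fL k)), (fun k => insubset (gK' k)); split.
- move=> k; apply: set_val_inj; rewrite val_insubset val_insubset.
  by apply: (tK _ _ _ _ _ L) => //; exact/tf/set_val_in.
- move=> k; apply: set_val_inj; rewrite val_insubset val_insubset.
  by apply: (tK _ _ _ _ _ K) => //; exact/tg/set_val_in.
- by apply: continuous_insubset; exact: ct.
- by apply: continuous_insubset; exact: ct.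
Qed.

(** * The brush of a compactum *)

Section hausdorff.
Context {R : realType}.
Local Notation Q := (hilbert_cube R).
Implicit Types (K L : hyperspace Q) (x : Q).

Lemma point_dist_le x a (A : set Q) : A a -> point_dist x A <= mdist x a.
Proof.
by move=> Aa; apply: ge_inf; [exists 0 => _ [b _ <-]; exact: mdist_ge0|exists a].
Qed.

Lemma point_dist_ge x r (A : set Q) : A !=set0 ->
  (forall a, A a -> r <= mdist x a) -> r <= point_dist x A.
Proof.
by move=> [a Aa] h; apply: lb_le_inf; [exists (mdist x a); exists a|move=> _ [b Ab <-]; exact: h].
Qed.

Lemma point_dist_lt x r (A : set Q) : A !=set0 ->
  point_dist x A < r -> exists2 a, A a & mdist x a < r.
Proof.
move=> [b Ab] /inf_lt; case; first by exists (mdist x b); exists b.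
by move=> _ [a Aa <-]; exists a.
Qed.

Lemma hyperspace_mdist_lt K L r : mdist K L < r ->
  forall a, hyperspace_set K a -> exists2 b, hyperspace_set L b & mdist a b < r.
Proof.
move=> KL a Ka; apply: point_dist_lt; first exact: hyperspace_nonempty.
apply: le_lt_trans KL; rewrite /mdist /= /hausdorff_dist le_max; apply/orP; left.
apply: ub_le_sup; last by exists a.
have [b Lb] := hyperspace_nonempty L.
by exists 1 => _ [c _ <-]; apply: le_trans (point_dist_le _ Lb) (mdist_le1 _ _).
Qed.

Lemma hyperspace_mdist_le K L r :
  (forall a, hyperspace_set K a -> exists2 b, hyperspace_set L b & mdist a b <= r) ->
  (forall b, hyperspace_set L b -> exists2 a, hyperspace_set K a & mdist b a <= r) -> mdist K L <= r.
Proof.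
have half (A C : hyperspace Q) :
    (forall a, hyperspace_set A a -> exists2 b, hyperspace_set C b & mdist a b <= r) ->
    sup [set point_dist a C | a in A : set Q] <= r.
  move=> h; have [a Aa] := hyperspace_nonempty A.
  apply: ge_sup; first by exists (point_dist a C); exists a.
  by move=> _ [b /h[c Cc bc] <-]; apply: le_trans bc; exact: point_dist_le.
by move=> hK hL; rewrite /mdist /= /hausdorff_dist ge_max !half.
Qed.

Lemma point_dist_lip K L r x : mdist K L < r -> point_dist x L <= point_dist x K + r.
Proof.
move=> KL; rewrite -lerBlDr; apply: point_dist_ge; first exact: hyperspace_nonempty.
move=> a Ka; have [b Lb ab] := hyperspace_mdist_lt KL Ka.
by have := point_dist_le x Lb; have := metric_triangle x a b; lra.
Qed.
End hausdorff.

HB.instance Definition _ (R : realType) :=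
  isPointed.Build (hilbert_cube R) (mkcube (fun=> 0)).

(* The sequence runs through finite [2^-m]-nets for all [m]; [eps n = 0] marks
   unused indices. *)
Lemma cube_net (R : realType) : exists (q : nat -> hilbert_cube R) (eps : nat -> R),
  [/\ forall n, 0 <= eps n <= 1, vanishing eps &
    forall x e, 0 < e -> exists n, [/\ 0 < eps n, eps n < e & mdist (q n) x < eps n]].
Proof.
pose Q := hilbert_cube R.
have net m : exists s : seq Q, forall x, exists2 y, y \in s & mdist y x < (2 ^+ m)^-1.
  have := @cube_compact R; rewrite compact_cover.
  move=> /(_ Q setT (fun y => [set x | mdist y x < (2 ^+ m)^-1])) [].
  - move=> y _; rewrite (_ : mkset _ = mdist y @^-1` [set r | r < (2 ^+ m)^-1])//.
    by apply: open_comp; [move=> ? _; exact: continuous_mdist|exact: open_lt].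
  - by move=> x _; exists x => //=; rewrite mdistxx invr_gt0 exprn_gt0.
  - by move=> D _ D1; exists (enum_fset D) => x; have [y yD yx] := D1 x I; exists y.
have [s sP] := choice net.
(* The index codes a pair (m, j) and stands for the j-th point of the m-th net. *)
pose q n : Q := if @choice.pickle_inv (nat * nat)%type n is Some (m, j) then nth point (s m) j else point.
pose eps n : R := if @choice.pickle_inv (nat * nat)%type n is Some (m, j) then
  if (j < size (s m))%N then (2 ^+ m)^-1 else 0 else 0.
exists q, eps; split.
- move=> n; rewrite /eps; case: pickle_inv => [[m j]|]; last by rewrite lexx ler01.
  by case: ifP => _; rewrite ?pow2V_itv ?lexx ?ler01.
- move=> e e0; have [M Me] := pow2V_lt e0.
  (* Radii of at least [e] occur only in the nets below level [M], hence at finitely many codes; the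
     bound is one more than the largest. *)
  exists (\max_(m < M) \max_(j < size (s m))
    @choice.pickle (nat * nat)%type (nat_of_ord m, nat_of_ord j)).+1 => n.
  move=> nM; rewrite ltNge; apply/negP => en; move: nM; apply/negP; rewrite -leqNgt; move: en; rewrite /eps.
  have := @choice.pickle_invK (nat * nat)%type n.
  case: pickle_inv => [[m j]|] /= => [mjn|_]; last by rewrite leNgt e0.
  case: ifP => [jm|_]; last by rewrite leNgt e0.
  have [/Me|mM _] := leqP M m; first by rewrite ltNge => /negP.
  rewrite -mjn; apply: leq_trans (leq_bigmax (Ordinal mM)) => /=.
  exact: leq_trans (leq_bigmax (Ordinal jm)).
- move=> x e e0; have [M /(_ M (leqnn M)) Me] := pow2V_lt e0.
  have [y ys yx] := sP M x; exists (@choice.pickle (nat * nat)%type (M, index y (s M))).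
  by rewrite /eps /q pickleK_inv index_mem ys nth_index// invr_gt0 exprn_gt0.
Qed.

(** If the index found is too small, the net property is applied again with its radius as the new
    bound: the next radius is strictly smaller, so the index is a different one. *)
Lemma cube_net_late (R : realType) (q : nat -> hilbert_cube R) (eps : nat -> R) :
  (forall x e, 0 < e -> exists n, [/\ 0 < eps n, eps n < e & mdist (q n) x < eps n]) ->
  forall x e N, 0 < e -> exists n, [/\ (N <= n)%N, 0 < eps n, eps n < e & mdist (q n) x < eps n].
Proof.
move=> h x e N; elim: N e => [|N IH] e e0; first by have [n [? ? ?]] := h x e e0; exists n.
have [n [Nn n0 ne nx]] := IH e e0.
have [Nn'|nN] := ltnP N n; first by exists n.
have [m [Nm m0 mn mx]] := IH (eps n) n0.
exists m; split => //; last exact: lt_trans ne.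
rewrite ltn_neqAle Nm andbT; apply/eqP => Nm'; move: mn.
by rewrite -Nm' (_ : n = N) ?ltxx//; apply/eqP; rewrite eqn_leq nN.
Qed.

(** * The reduction and its continuity *)

Section reduction.
Context {R : realType}.
Local Notation Q := (hilbert_cube R).
Context (q : nat -> Q) (eps : nat -> R).
Hypothesis eps01 : forall n, 0 <= eps n <= 1.
Hypothesis eps_van : vanishing eps.
Hypothesis q_net : forall x e, 0 < e ->
  exists n, [/\ 0 < eps n, eps n < e & mdist (q n) x < eps n].
Implicit Types K L : hyperspace Q.
Local Notation foot := (foot q).

Definition hair_length K n : R := Num.max 0 (eps n - point_dist (q n) K).

Lemma point_dist_ge0 x K : 0 <= point_dist x K.
Proof. by apply: point_dist_ge => [|a _]; [exact: hyperspace_nonempty|exact: mdist_ge0]. Qed.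

Lemma hair_length_le K n : hair_length K n <= eps n.
Proof.
by have /andP[e0 _] := eps01 n; rewrite ge_max e0 lerBlDr lerDl point_dist_ge0.
Qed.

Lemma hair_length_itv K n : 0 <= hair_length K n <= 1.
Proof.
by rewrite le_max lexx /= (le_trans (hair_length_le K n))//; case/andP: (eps01 n).
Qed.

Lemma hair_length_van K : vanishing (hair_length K).
Proof.
by move=> e /eps_van[M Me]; exists M => n /Me; exact: le_lt_trans (hair_length_le K n).
Qed.

Lemma hair_length_gt0 K n k : hyperspace_set K k -> mdist (q n) k < eps n -> 0 < hair_length K n.
Proof.
move=> Kk nk; rewrite lt_max subr_gt0; apply/orP; right.
exact: le_lt_trans (point_dist_le _ Kk) nk.
Qed.

Lemma hair_near K n : 0 < hair_length K n -> exists2 k, hyperspace_set K k & mdist (q n) k < eps n.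
Proof.
rewrite lt_max ltxx /= subr_gt0; apply: point_dist_lt; exact: hyperspace_nonempty.
Qed.

Lemma mdist_foot k n : mdist (foot n) (place 0 k) <= (2 ^+ n)^-1 + mdist (q n) k.
Proof.
apply: le_trans (mdist_place _ _ (pow2V_itv n) _) _; first by rewrite lexx ler01.
by rewrite subr0 ger0_norm// invr_ge0 exprn_ge0.
Qed.

Lemma pow2V_eps_van : vanishing (fun n => (2 ^+ n)^-1 + eps n).
Proof.
move=> e e0; have e2 : 0 < e / 2 by rewrite divr_gt0.
have [M Me] := eps_van e2; have [N Ne] := pow2V_lt e2.
exists (maxn M N) => n; rewrite geq_max => /andP[/Me ? /Ne ?]; lra.
Qed.

Definition feet K : set Q := place 0 @` K `|` foot @` [set n | 0 < hair_length K n].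

Lemma closed_feet K : closed (feet K).
Proof.
have /choice[c cP] n : exists c, 0 < hair_length K n ->
    hyperspace_set K c /\ mdist (q n) c < eps n.
  have [/hair_near[c Kc nc]|n0] := pselect (0 < hair_length K n); first by exists c.
  by exists point.
apply: (closedU_vanishing (c := fun n => place 0 (c n)) _ _ _ pow2V_eps_van).
- apply: compact_closed; first exact: metric_hausdorff.
  apply: continuous_compact; last exact: hyperspace_compact.
  by apply: continuous_subspaceT; exact: continuous_place.
- by move=> n /cP[Kc _]; exists (c n).
- move=> n /cP[_ nc]; apply: le_trans (mdist_foot _ _) _.
  by rewrite lerD2l ltW.
Qed.

Lemma feet_dense K k e N : hyperspace_set K k -> 0 < e -> exists n,
  [/\ (N <= n)%N, 0 < hair_length K n, mdist (q n) k < eps n & mdist (place 0 k) (foot n) < e].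
Proof.
move=> Kk e0; have e2 : 0 < e / 2 by rewrite divr_gt0.
have [M Me] := pow2V_lt e2.
have [n [Nn n0 ne nk]] := cube_net_late q_net k (maxn N M) e2.
move: Nn; rewrite geq_max => /andP[Nn /Me Mn]; exists n; split => //.
  exact: hair_length_gt0 nk.
by rewrite metric_sym; apply: le_lt_trans (mdist_foot _ _) _; lra.
Qed.

Lemma brush_nonempty l : brush q l !=set0.
Proof. by exists (foot 0); left; exact: crd_place0. Qed.

Definition reduction K : hyperspace Q := Hyperspace (brush_nonempty (hair_length K))
  (brush_compact (hair_length_itv K) (hair_length_van K)).

Lemma reduction_AR K : @AR R (reduction K).
Proof.
exists (reduction K); split.
  exact: (@brush_retract R q (hair_length K) (hair_length_itv K) (hair_length_van K)).
by exists id, id; split => // x; exact: cvg_id.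
Qed.

Lemma mdist_raise (s t : R) (x : Q) : 0 <= s <= 1 -> 0 <= t <= 1 ->
  mdist (raise s x) (raise t x) <= `|s - t|.
Proof.
move=> s01 t01; apply: mdist_le => -[|i]; first by rewrite !crd_raise0// expr0 mul1r.
by rewrite !crd_raiseS subrr normr0 mulr_ge0 ?exprn_ge0.
Qed.

(** Base and feet do not depend on [K], and the hair lengths are 1-Lipschitz in [K] uniformly in n.
    Cutting the height of a point down to the new length thus moves it by at most the bound on the
    Hausdorff distance. *)
Lemma continuous_reduction : continuous reduction.
Proof.
apply/continuous_mdistP => K e e0; have e2 : 0 < e / 2 by rewrite divr_gt0.
have half (A C : hyperspace Q) : mdist A C < e / 2 -> forall x, brush q (hair_length A) x ->
    exists2 y, brush q (hair_length C) y & mdist x y <= e / 2.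
  move=> AC x [x0|[n [/andP[x0 xl] xn]]]; first by exists x; [left|rewrite mdistxx ltW].
  have lC : hair_length A n <= hair_length C n + e / 2.
    have pd := point_dist_lip (q n) AC; have /andP[C0 _] := hair_length_itv C n.
    have : eps n - point_dist (q n) C <= hair_length C n by rewrite le_max lexx orbT.
    by rewrite {2}/hair_length ge_max => ?; apply/andP; split; lra.
  have /andP[C0 C1] := hair_length_itv C n; have /andP[? ?] := crd_itv x 0.
  have m01 : 0 <= Num.min (crd x 0) (hair_length C n) <= 1.
    by rewrite le_min ge_min C0 C1 orbT andbT ltW.
  exists (raise (Num.min (crd x 0) (hair_length C n)) (foot n)).
    by apply: brush_raise => //; rewrite ge_min lexx orbT.
  rewrite -{1}(raise_id x) -(raise_raise _ 0) xn.
  apply: le_trans (mdist_raise _ (crd_itv _ _) m01) _.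
  by rewrite minEle; case: ifPn; rewrite ?subrr ?normr0 -?ltNge => h; rewrite ?ger0_norm; lra.
apply: filterS (near_mdist K e2) => L KL; apply: (@le_lt_trans _ _ (e / 2)); last lra.
by apply: hyperspace_mdist_le; apply: half => //; rewrite metric_sym.
Qed.

Lemma reduction_recover K L :
  homeo_compacta (reduction K) (reduction L) -> homeo_compacta K L.
Proof.
apply: brush_recover; try exact: hair_length_itv; try exact: closed_feet.
  by move=> k e Kk e0; have [n []] := feet_dense 0 Kk e0; exists n.
by move=> k e Kk e0; have [n []] := feet_dense 0 Kk e0; exists n.
Qed.
End reduction.

(** * Matching the hairs *)

(** Injectivity comes from choosing every value beyond all earlier ones; [b n] is a bound exceeding
    the values chosen before [n]. *)
Lemma increasing_choice (A B : set nat) (P : nat -> nat -> Prop) :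
  (forall n N, A n -> exists m, [/\ (N <= m)%N, B m & P n m]) ->
  exists f : nat -> nat, [/\ forall n, A n -> B (f n), forall n, A n -> P n (f n) &
    forall n m, A n -> A m -> f n = f m -> n = m].
Proof.
move=> h; have /choice[c cP] (p : nat * nat) : exists m, A p.1 -> [/\ (p.2 <= m)%N, B m & P p.1 m].
  have [Ap|nAp] := pselect (A p.1); last by exists 0%N.
  by have [m mP] := h p.1 p.2 Ap; exists m.
pose b := fix b n := if n is k.+1 then maxn (b k) (c (k, b k)).+1 else 0%N.
pose f n := c (n, b n).
have bm n m : (n <= m)%N -> (b n <= b m)%N.
  elim: m => [|m IH]; first by rewrite leqn0 => /eqP ->.
  rewrite leq_eqVlt => /predU1P[->//|/IH nm]; exact: leq_trans nm (leq_maxl _ _).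
have fm n m : A m -> (n < m)%N -> (f n < f m)%N.
  move=> Am nm; have [bf _ _] := cP (m, b m) Am; apply: leq_trans bf => /=.
  by apply: leq_trans (bm _ _ nm); exact: leq_maxr.
exists f; split => [n /(cP (n, b n))[]//|n /(cP (n, b n))[]//|n m An Am fnm].
by case: (ltngtP n m) => // nm; [have := fm _ _ Am nm|have := fm _ _ An nm]; rewrite fnm ltnn.
Qed.

(* The Schroeder-Bernstein bijection coincides at each point with [f] or with
   the inverse of [g], so it stays within the relation [P]. *)
Lemma schroeder_bernstein_rel (A B : set nat) (P : nat -> nat -> Prop) (f g : nat -> nat) :
  (forall n, A n -> B (f n)) -> (forall n, A n -> P n (f n)) ->
  (forall n m, A n -> A m -> f n = f m -> n = m) ->
  (forall n, B n -> A (g n)) -> (forall n, B n -> P (g n) n) ->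
  (forall n m, B n -> B m -> g n = g m -> n = m) ->
  exists s t : nat -> nat, [/\ forall n, A n -> B (s n), forall n, B n -> A (t n),
    forall n, A n -> t (s n) = n, forall n, B n -> s (t n) = n & forall n, A n -> P n (s n)].
Proof.
move=> fB fP fI gA gP gI.
pose Z : set nat := [set a | exists k a0, [/\ A a0, forall b, B b -> g b <> a0 & a = iter k (g \o f) a0]].
have ZA a : Z a -> A a.
  move=> [k [a0 [Aa0 _ ->]]]; elim: k => //= k IH; exact/gA/fB.
have Zgf a : Z a -> Z (g (f a)).
  by move=> [k [a0 [? ? ->]]]; exists k.+1, a0; split.
pose gi a := xget 0%N [set b | B b /\ g b = a].
have giP a : A a -> ~ Z a -> B (gi a) /\ g (gi a) = a.
  move=> Aa nZ; apply: (@xgetPex _ 0%N [set b | B b /\ g b = a]); apply: contrapT => /forallNP h.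
  by apply: nZ; exists 0%N, a; split => // b Bb gb; apply: (h b).
pose s a := if pselect (Z a) then f a else gi a.
have sZ a : Z a -> s a = f a by rewrite /s; case: pselect.
have sN a : ~ Z a -> s a = gi a by rewrite /s; case: pselect.
have sB a : A a -> B (s a).
  move=> Aa; have [Za|nZ] := pselect (Z a); first by rewrite sZ//; exact: fB.
  by rewrite sN//; case: (giP a).
have sP a : A a -> P a (s a).
  move=> Aa; have [Za|nZ] := pselect (Z a); first by rewrite sZ//; exact: fP.
  by rewrite sN//; have [Bg {1}<-] := giP a Aa nZ; exact: gP.
have mixed a a' : A a' -> Z a -> ~ Z a' -> s a <> s a'.
  move=> Aa' Za nZ; rewrite sZ// sN// => fg; apply: (nZ).
  by have [_ <-] := giP a' Aa' nZ; rewrite -fg; exact: Zgf.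
have sI a a' : A a -> A a' -> s a = s a' -> a = a'.
  move=> Aa Aa'; have [Za|nZ] := pselect (Z a); have [Za'|nZ'] := pselect (Z a').
  - by rewrite !sZ//; exact: fI.
  - by move=> /mixed; case.
  - by move=> /esym/mixed; case.
  - by rewrite !sN// => gg; have [_ <-] := giP a Aa nZ; have [_ <-] := giP a' Aa' nZ'; rewrite gg.
have sS b : B b -> exists a, A a /\ s a = b.
  move=> Bb; have [Zg|nZ] := pselect (Z (g b)); last first.
    exists (g b); split; first exact: gA.
    by rewrite sN//; have [Bgi gg] := giP _ (gA _ Bb) nZ; exact: gI.
  have [[|k] [a0 [Aa0 na0 ge]]] := Zg; first by case: (na0 b).
  have Za : Z (iter k (g \o f) a0) by exists k, a0.
  exists (iter k (g \o f) a0); split; first exact: ZA.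
  by rewrite sZ//; apply: gI => //; exact/fB/ZA.
pose t b := xget 0%N [set a | A a /\ s a = b].
have tP b : B b -> A (t b) /\ s (t b) = b.
  by move=> Bb; apply: (@xgetPex _ 0%N [set a | A a /\ s a = b]); exact: sS.
exists s, t; split => // [b /tP[]//|a Aa|b /tP[]//].
by have [? ?] := tP _ (sB _ Aa); exact: sI.
Qed.

(** * Klee's trick *)

Section klee.
Context {R : realType}.
Local Notation Q := (hilbert_cube R).

(* In the coordinate [x / (1 - x)] this is multiplication by [s / (1 - s)]. *)
Definition moebius (s x : R) := s * x / (s * x + (1 - s) * (1 - x)).

Lemma moebius_den (s x : R) : 0 < s < 1 -> 0 <= x <= 1 -> 0 < s * x + (1 - s) * (1 - x).
Proof. by move=> /andP[? ?] /andP[? ?]; nra. Qed.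

Lemma moebius_itv (s x : R) : 0 < s < 1 -> 0 <= x <= 1 -> 0 <= moebius s x <= 1.
Proof.
move=> s01 x01; have d0 := moebius_den s01 x01; rewrite /moebius.
move: s01 x01 => /andP[? ?] /andP[? ?].
by apply/andP; split; [apply: divr_ge0; nra|rewrite ler_pdivrMr//; nra].
Qed.

(** The factor s / (1 - s) has as reciprocal the factor of the parameter 1 - s. *)
Lemma moebiusK (s x : R) : 0 < s < 1 -> 0 <= x <= 1 -> moebius (1 - s) (moebius s x) = x.
Proof.
move=> s01 x01; have d0 := moebius_den s01 x01; rewrite /moebius.
move: s01 => /andP[? ?]; set d := s * x + _ in d0 *.
have dE : d = s * x + (1 - s) * (1 - x) by [].
have -> : 1 - s * x / d = (1 - s) * (1 - x) / d by rewrite dE; field; rewrite -dE gt_eqF.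
have -> : (1 - s) * (s * x / d) + (1 - (1 - s)) * ((1 - s) * (1 - x) / d) = s * (1 - s) / d.
  by field; rewrite gt_eqF.
by field; rewrite !gt_eqF// subr_gt0.
Qed.

Lemma moebius_half (s : R) : moebius s 2^-1 = s.
Proof.
rewrite /moebius (_ : s * 2^-1 + (1 - s) * (1 - 2^-1) = 2^-1); last by field.
by rewrite invrK mulrVK// unitfE.
Qed.

Lemma moebius_opp (s : R) : 0 < s < 1 -> moebius (1 - s) s = 2^-1.
Proof.
move=> /andP[? ?]; rewrite /moebius; field.
by rewrite gt_eqF//; have := mulr_gt0 (_ : 0 < s) (_ : 0 < 1 - s); nra.
Qed.

Lemma continuous_moebius (T : topologicalType) (s x : T -> R) :
  (forall z, 0 < s z < 1) -> (forall z, 0 <= x z <= 1) -> continuous s -> continuous x ->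
  continuous (fun z => moebius (s z) (x z)).
Proof.
move=> s01 x01 cs cx; apply: continuous_mulr; first exact: continuous_mulr.
have c1 (f : T -> R) : continuous f -> continuous (fun z => 1 - f z).
  by move=> cf; apply: continuous_subr => //; exact: cst_continuous.
have cd : continuous (fun z => s z * x z + (1 - s z) * (1 - x z)).
  by apply: continuous_addr; apply: continuous_mulr => //; exact: c1.
move=> z; apply: (@cvgV R); last exact: cd.
by rewrite gt_eqF// moebius_den.
Qed.

Definition anchor (x : Q) : Q := mkcube (fun i =>
  if i is k.+1 then if odd k then 2^-1 else crd x i else 0).

(** Coordinate 2j + 2 is moved by a homeomorphism of [0, 1] that takes 1/2 to [h j]. The parameter
    is read off the odd coordinates, which stay fixed, so the move can be undone. *)
Definition slide (h : nat -> Q -> R) (x : Q) : Q := mkcube (fun i =>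
  if i is k.+1 then
    if odd k then moebius (h k./2 (anchor x)) (crd x i) else crd x i
  else crd x i).

Definition swap_halves (x : Q) : Q := mkcube (fun i =>
  if i is k.+1 then if odd k then crd x k else crd x k.+2 else crd x i).

Lemma crd_anchor x i :
  crd (anchor x) i = if i is k.+1 then if odd k then 2^-1 else crd x i else 0.
Proof.
rewrite crd_mk_id//; case: i => [|i]; rewrite ?lexx ?ler01//.
by case: ifP; rewrite ?crd_itv// => _; apply/andP; split; lra.
Qed.

Lemma crd_swap x i : crd (swap_halves x) i =
  if i is k.+1 then if odd k then crd x k else crd x k.+2 else crd x i.
Proof. by rewrite crd_mk_id//; case: i => [|i]; [|case: ifP]; rewrite crd_itv. Qed.

Lemma swapK : involutive swap_halves.
Proof.
move=> x; apply: crd_inj => -[|i]; first by rewrite !crd_swap.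
rewrite crd_swap; case: ifPn => [|iE]; last by rewrite crd_swap /= iE.
by case: i => // i /= iE; rewrite crd_swap (negbTE iE).
Qed.

Lemma continuous_swap : continuous swap_halves.
Proof.
by apply: continuous_mkcube => -[|k]; [exact: continuous_crd|case: odd; exact: continuous_crd].
Qed.

Lemma continuous_anchor : continuous anchor.
Proof.
apply: continuous_mkcube => -[|k]; first exact: cst_continuous.
by case: odd; [exact: cst_continuous|exact: continuous_crd].
Qed.

Definition inner (h : nat -> Q -> R) := forall j x, 0 < h j x < 1.

Section slide.
Context (h : nat -> Q -> R).
Hypothesis h01 : inner h.

Lemma crd_slide x i : crd (slide h x) i =
  if i is k.+1 then
    if odd k then moebius (h k./2 (anchor x)) (crd x i) else crd x i
  else crd x i.
Proof.
rewrite crd_mk_id//; case: i => [|i]; first by rewrite crd_itv.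
by case: ifP => _; [apply: moebius_itv; [exact: h01|exact: crd_itv]|exact: crd_itv].
Qed.

Lemma anchor_slide x : anchor (slide h x) = anchor x.
Proof.
by apply: crd_inj => -[|i]; rewrite !crd_anchor// crd_slide; case: (odd i).
Qed.

Lemma continuous_slide : (forall j, continuous (h j)) -> continuous (slide h).
Proof.
move=> ch; apply: continuous_mkcube => -[|k]; first exact: continuous_crd.
case: odd; last exact: continuous_crd.
apply: continuous_moebius; [by move=> z; exact: h01|by move=> z; exact: crd_itv| |exact: continuous_crd].
by move=> x; apply: continuous_comp; [exact: continuous_anchor|exact: ch].
Qed.
End slide.

Lemma slideK h h' : inner h -> inner h' -> (forall j x, h' j x = 1 - h j x) ->
  cancel (slide h) (slide h').
Proof.
move=> h01 h'01 hh x; apply: crd_inj => -[|i]; first by rewrite !crd_slide.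
rewrite crd_slide// anchor_slide//; case: ifP => iE; rewrite crd_slide// iE//.
by rewrite hh moebiusK ?crd_itv.
Qed.

(* Klee's trick: the first slide turns the compactum [E] of the first factor
   into the graph of a map [E -> E'], the second one turns the graph, seen over
   [E'], into the compactum [E'] of the other factor. *)
Definition klee (h g : nat -> Q -> R) (x : Q) : Q :=
  slide (fun j y => 1 - g j y) (swap_halves (slide h x)).

Lemma inner_opp h : inner h -> inner (fun j y => 1 - h j y).
Proof. by move=> h01 j x; have /andP[? ?] := h01 j x; apply/andP; split; lra. Qed.

Lemma kleeK h g : inner h -> inner g -> cancel (klee h g) (klee g h).
Proof.
move=> h01 g01 x; have h'01 := inner_opp h01; have g'01 := inner_opp g01.
rewrite /klee (slideK g'01 g01) => [|j y]; last by rewrite subKr.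
by rewrite swapK (slideK h01 h'01).
Qed.

Lemma continuous_klee h g : inner h -> inner g -> (forall j, continuous (h j)) ->
  (forall j, continuous (g j)) -> continuous (klee h g).
Proof.
move=> h01 g01 ch cg x.
apply: (@continuous_comp _ _ _ (swap_halves \o slide h)).
  by apply: continuous_comp; [exact: continuous_slide|exact: continuous_swap].
apply: continuous_slide; first exact: inner_opp.
by move=> j; apply: continuous_subr => //; exact: cst_continuous.
Qed.

Lemma crd_klee0 h g x : inner h -> inner g -> crd (klee h g x) 0 = crd x 0.
Proof. by move=> h01 g01; rewrite crd_slide ?crd_swap ?crd_slide//; exact: inner_opp. Qed.

Lemma klee_raise h g s x : inner h -> inner g -> 0 <= s <= 1 ->
  klee h g (raise s x) = raise s (klee h g x).
Proof.
move=> h01 g01 s01; have g'01 := inner_opp g01.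
have ar y : anchor (raise s y) = anchor y.
  by apply: crd_inj => -[|i]; rewrite !crd_anchor// crd_raiseS.
have sr f y : inner f -> slide f (raise s y) = raise s (slide f y).
  move=> f01; apply: crd_inj => -[|i]; first by rewrite crd_slide// !crd_raise0.
  by rewrite crd_raiseS !crd_slide// ar crd_raiseS.
have wr y : swap_halves (raise s y) = raise s (swap_halves y).
  apply: crd_inj => -[|i]; first by rewrite crd_swap !crd_raise0.
  by rewrite crd_raiseS !crd_swap crd_raiseS; case: i => //= i; rewrite crd_raiseS.
by rewrite /klee sr// wr sr.
Qed.

Lemma klee_anchor h g e e' : inner h -> inner g -> anchor e = e -> anchor e' = e' ->
  (forall j, h j e = crd e' j.*2.+1) -> (forall j, g j e' = crd e j.*2.+1) ->
  klee h g e = e'.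
Proof.
move=> h01 g01 ae ae' he ge; have g'01 := inner_opp g01.
(* Halfway, the odd coordinates are those of [e'] and the even ones store those of [e]. As [g j e']
   is the stored value, the second slide resets it to 1/2. *)
have aw : anchor (swap_halves (slide h e)) = e'.
  apply: crd_inj => i; rewrite -ae' !crd_anchor; case: i => // i; case: ifPn => // iE.
  rewrite crd_swap (negbTE iE) crd_slide//= iE ae -ae crd_anchor /= iE moebius_half.
  by rewrite ae he -[in RHS](odd_double_half i) (negbTE iE) add0n uphalf_half (negbTE iE).
apply: crd_inj => i; rewrite crd_slide//; case: i => [|i].
  by rewrite crd_swap crd_slide// -ae -ae' !crd_anchor.
case: ifPn => iE; last by rewrite -[in RHS]aw crd_anchor (negbTE iE).
rewrite aw ge -[in RHS]ae' crd_anchor iE crd_swap iE.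
have -> : (i./2).*2.+1 = i by rewrite -[RHS](odd_double_half i) iE.
rewrite crd_slide//; case: i iE => // i /= iE; rewrite (negbTE iE).
have := g01 i./2 e'; rewrite ge.
have -> : (i./2).*2.+1 = i.+1 by rewrite -[in RHS](odd_double_half i) (negbTE iE).
exact: moebius_opp.
Qed.

(** Tietze's theorem is applied to each coordinate minus 1/2, with bound 1/4. The extension stays in
    [1/4, 3/4], so it is a valid Möbius parameter; this is why placed points use only that range. *)
Lemma cube_tietze (E : set Q) (H : Q -> Q) : closed E -> {within E, continuous H} ->
  (forall x j, E x -> 4^-1 <= crd (H x) j.*2.+1 <= 3 / 4) ->
  exists h : nat -> Q -> R, [/\ inner h, forall j, continuous (h j) &
    forall j x, E x -> h j x = crd (H x) j.*2.+1].
Proof.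
move=> Ecl cH Hb; have /choice[h hP] j : exists f : Q -> R, [/\ forall x, 0 < f x < 1,
    continuous f & forall x, E x -> f x = crd (H x) j.*2.+1].
  have cf : {within E, continuous (fun x => crd (H x) j.*2.+1 - 2^-1 : R^o)}.
    move=> x; apply: (@continuous_comp _ _ _ (H : subspace E -> Q) (fun y => crd y j.*2.+1 - 2^-1 : R^o)).
      exact: cH.
    by apply: continuous_subr; [exact: continuous_crd|exact: cst_continuous].
  have [|x Ex|f [fE cf' fb]] := continuous_bounded_extension
      (@pseudometric_normal R Q) Ecl (_ : 0 < 4^-1) cf _ => //.
    by have := Hb x j Ex => /andP[? ?]; rewrite ler_norml; apply/andP; split; lra.
  exists (fun x => f x + 2^-1); split.
  - by move=> x; have := fb x; rewrite ler_norml => /andP[? ?]; apply/andP; split; lra.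
  - by apply: continuous_addr => //; exact: cst_continuous.
  - by move=> x Ex; rewrite -fE ?inE// subrK.
by exists h; split => [j|j|j]; have [] := hP j.
Qed.
End klee.

(** * Homeomorphic compacta have homeomorphic brushes *)

Definition continuous_on (R : realType) (M : metricType R) (A : set M) (f : M -> M) :=
  forall x e, A x -> 0 < e -> exists2 d, 0 < d &
    forall y, A y -> mdist x y < d -> mdist (f x) (f y) < e.

Lemma total_extension (R : realType) (K L : set (hilbert_cube R))
    (f : set_type K -> set_type L) : continuous f ->
  exists F : hilbert_cube R -> hilbert_cube R,
    (forall k, F (set_val k) = set_val (f k)) /\ continuous_on K F.
Proof.
move=> cf; pose F x := if pselect (K x) is left Kx then set_val (f (insubset Kx)) else point.
have FE k : F (set_val k) = set_val (f k).
  rewrite /F; case: pselect => [Kk|/(_ (set_val_in k))//].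
  by congr (set_val (f _)); apply: set_val_inj; rewrite val_insubset.
exists F; split => // x e Kx e0.
have cvf : continuous (fun k => set_val (f k)).
  by move=> k; apply: (@continuous_comp _ _ _ f set_val); [exact: cf|exact: continuous_set_val].
have /continuous_mdistP/(_ (insubset Kx) e e0) := cvf.
move=> [V [[W oW <-] /= Wx] WU]; rewrite val_insubset in Wx.
have /metricType_numDomainType.nbhs_mdistP[d /= d0 dW] : nbhs x W by exact: open_nbhs_nbhs.
exists d => // y Ky /dW Wy; have := WU (insubset Ky); rewrite /= val_insubset => /(_ Wy).
by rewrite -!FE !val_insubset.
Qed.

(** * Linear rescaling of the hairs *)

Section rescale.
Context {R : realType}.
Local Notation Q := (hilbert_cube R).
Context (q : nat -> Q) (l m : nat -> R) (s t : nat -> nat) (T : Q -> Q).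
Hypothesis l01 : forall n, 0 <= l n <= 1.
Hypothesis m01 : forall n, 0 <= m n <= 1.
Hypothesis m_van : vanishing m.
Hypothesis s_pos : forall n, 0 < l n -> 0 < m (s n).
Hypothesis sK : forall n, 0 < l n -> t (s n) = n.
Hypothesis cT : continuous T.
Hypothesis T0 : forall x, crd (T x) 0 = crd x 0.
Hypothesis T_raise : forall c x, 0 <= c <= 1 -> T (raise c x) = raise c (T x).
Hypothesis T_foot : forall n, 0 < l n -> T (foot q n) = foot q (s n).
Local Notation foot := (foot q).

Definition foot_index (x : Q) : nat := xget 0%N [set n | raise 0 x = foot n].

Lemma foot_indexE x n : raise 0 x = foot n -> foot_index x = n.
Proof.
move=> xn; apply: (@foot_inj _ q); rewrite -xn; apply/esym.
by apply: (@xgetPex _ 0%N [set n | raise 0 x = foot n]); exists n.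
Qed.

(** On the base the height is 0, so the result is [T x] whatever index is returned; on hair n the
    height is multiplied by the ratio of the new length to the old. *)
Definition rescale (x : Q) : Q :=
  raise (crd x 0 * (m (s (foot_index x)) / l (foot_index x))) (T x).

Lemma rescale_base x : crd x 0 = 0 -> rescale x = T x.
Proof. by move=> x0; rewrite /rescale x0 mul0r -x0 -T0 raise_id. Qed.

Lemma rescale_hair x n : raise 0 x = foot n -> 0 < crd x 0 <= l n ->
  rescale x = raise (crd x 0 * (m (s n) / l n)) (foot (s n)).
Proof.
move=> xn /andP[x0 xl]; have ln := lt_le_trans x0 xl.
by rewrite /rescale (foot_indexE xn) -(T_foot ln) -xn T_raise ?lexx ?ler01// raise_raise.
Qed.

Lemma scale_itv x n : 0 < crd x 0 <= l n -> 0 < crd x 0 * (m (s n) / l n) <= m (s n).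
Proof.
move=> /andP[x0 xl]; have ln := lt_le_trans x0 xl; have mn := s_pos ln.
apply/andP; split; first by rewrite mulr_gt0// divr_gt0.
by rewrite mulrCA ger_pMr// ler_pdivrMr// mul1r.
Qed.

Lemma rescale_brush x : brush q l x -> brush q m (rescale x).
Proof.
move=> [x0|[n [xl xn]]]; first by left; rewrite rescale_base// T0.
rewrite (rescale_hair xn xl); have /andP[c0 cm] := scale_itv xl.
apply: brush_raise => //; rewrite ltW//=; apply: le_trans cm _.
by case/andP: (m01 (s n)).
Qed.

(** On the nondegenerate hairs [s] has the left inverse [t], so [s n] is below [M] only for the
    finitely many [n] among [t 0], ..., [t (M - 1)]. *)
Lemma vanishing_reindex : vanishing (fun n => if 0 < l n then m (s n) else 0).
Proof.
move=> e e0; have [M Me] := m_van e0.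
exists (\max_(i < M) t i).+1 => n nM; case: ifP => // ln; apply: Me.
rewrite leqNgt; apply/negP => snM; move: nM; apply/negP; rewrite -leqNgt -{1}(sK ln).
exact: (leq_bigmax (Ordinal snM)).
Qed.

(** Only the height is delicate. It is the selected term of the continuous functions [g n]: the
    tents kill all other terms on the brush, and the new lengths, which tend to 0, bound them. *)
Lemma continuous_rescale : continuous (fun x : set_type (brush q l) => rescale (set_val x)).
Proof.
have cv := @continuous_set_val _ (brush q l).
apply: continuous_mkcube => -[|i]; last first.
  move=> x; apply: (@continuous_comp _ _ _ set_val (fun x => crd (T x) i.+1)); first exact: cv.
  by apply: (@continuous_comp _ _ _ T (fun y => crd y i.+1)); [exact: cT|exact: continuous_crd].
pose g n (x : set_type (brush q l)) := crd (set_val x) 0 * tent q n (set_val x) * (m (s n) / l n).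
have bN n x : brush q l x -> n <> foot_index x -> crd x 0 * tent q n x = 0.
  move=> [->|[k [_ xk]]]; first by rewrite mul0r.
  by rewrite (foot_indexE xk) => nk; rewrite (tent0 nk xk) mulr0.
have b1 x : brush q l x -> crd x 0 * tent q (foot_index x) x = crd x 0.
  move=> [->|[k [_ xk]]]; first by rewrite mul0r.
  by rewrite (foot_indexE xk) tent1// mulr1.
rewrite (_ : (fun _ => _) = fun x => g (foot_index (set_val x)) x); last first.
  by apply/funext => x; rewrite /g b1//; exact: set_val_in.
apply: (continuous_selected (a := fun n => if 0 < l n then m (s n) else 0)).
- move=> n; apply: continuous_mulr; last exact: cst_continuous.
  move=> x; apply: (@continuous_comp _ _ _ set_val (fun x => crd x 0 * tent q n x)); first exact: cv.
  by apply: continuous_mulr; [exact: continuous_crd|exact: continuous_tent].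
- by move=> n x nx; rewrite /g bN ?mul0r//; exact: set_val_in.
- move=> n x; rewrite /g; have /andP[ln0 _] := l01 n; have /andP[m0 _] := m01 (s n).
  have [->|/eqP nx] := eqVneq n (foot_index (set_val x)); last first.
    by rewrite bN ?mul0r ?normr0//; [case: ifP|exact: set_val_in].
  rewrite b1; last exact: set_val_in.
  have [->|[k [xl xk]]] := set_val_in x.
    rewrite mul0r normr0; case: ifP => // _.
    by case/andP: (m01 (s (foot_index (set_val x)))).
  rewrite (foot_indexE xk); have /andP[c0 cm] := scale_itv xl.
  by move: xl => /andP[x0 xl]; rewrite (lt_le_trans x0 xl) ger0_norm// ltW.
- exact: vanishing_reindex.
Qed.
End rescale.

Lemma rescaleK (R : realType) (q : nat -> hilbert_cube R) (l m : nat -> R) (s t : nat -> nat)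
    (T T' : hilbert_cube R -> hilbert_cube R) :
  (forall n, 0 < l n -> 0 < m (s n)) -> (forall n, 0 < l n -> t (s n) = n) ->
  (forall n, 0 <= m n <= 1) ->
  (forall x, crd (T x) 0 = crd x 0) -> (forall x, crd (T' x) 0 = crd x 0) ->
  (forall c x, 0 <= c <= 1 -> T (raise c x) = raise c (T x)) ->
  (forall c x, 0 <= c <= 1 -> T' (raise c x) = raise c (T' x)) ->
  (forall n, 0 < l n -> T (foot q n) = foot q (s n)) ->
  (forall n, 0 < m n -> T' (foot q n) = foot q (t n)) ->
  cancel T T' -> forall x, brush q l x ->
  rescale q m l t T' (rescale q l m s T x) = x.
Proof.
move=> sp sK m01 T0 T'0 Tr T'r Tf T'f TK x [x0|[n [xl xn]]].
  by rewrite (rescale_base q l m s T0 x0) (rescale_base q m l t T'0) ?TK// T0.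
have /andP[c0 cm] := scale_itv sp xl; have /andP[_ m1] := m01 (s n).
have /andP[x0 xln] := xl; have ln := lt_le_trans x0 xln; have mn := sp _ ln.
rewrite (rescale_hair m Tr Tf xn xl) (rescale_hair l T'r T'f (n := s n)).
- rewrite sK// crd_raise0; last by rewrite ltW//= (le_trans cm).
  rewrite (_ : _ * _ = crd x 0); first by rewrite -xn raise_raise raise_id.
  by field; rewrite !gt_eqF.
- by rewrite raise_raise foot_raise.
- by rewrite crd_raise0 ?c0// ltW//= (le_trans cm).
Qed.

(** * Extending a homeomorphism of compacta over the feet *)

Section feet.
Context {R : realType}.
Local Notation Q := (hilbert_cube R).
Context (q : nat -> Q) (eps : nat -> R).
Hypothesis eps01 : forall n, 0 <= eps n <= 1.
Hypothesis eps_van : vanishing eps.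
Hypothesis q_net : forall x e, 0 < e ->
  exists n, [/\ 0 < eps n, eps n < e & mdist (q n) x < eps n].
Local Notation foot := (foot q).
Local Notation hair_length := (hair_length q eps).
Local Notation feet := (feet q eps).

Lemma crd_place_itv (t : R) (k : Q) j : 0 <= t <= 1 ->
  4^-1 <= crd (place t k) j.*2.+1 <= 3 / 4.
Proof.
move=> t01; case: j => [|j].
  by rewrite crd_place1//; move: t01 => /andP[? ?]; apply/andP; split; lra.
by rewrite crd_place_odd; have /andP[? ?] := crd_itv k j; apply/andP; split; lra.
Qed.

Lemma anchor_place (t : R) (k : Q) : anchor (place t k) = place t k.
Proof.
apply: crd_inj => -[|i]; rewrite crd_anchor ?crd_place0//; case: ifPn => // iE.
by case: i iE => // i /= iE; rewrite -[i]odd_double_half (negbTE iE) add0n crd_place_even.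
Qed.

Definition feet_map (A : set nat) (s : nat -> nat) (F : Q -> Q) (x : Q) : Q :=
  if pselect (exists n, A n /\ foot n = x) is left e then foot (s (projT1 (cid e)))
  else place 0 (F (unplace x)).

Lemma feet_map_foot A s F n : A n -> feet_map A s F (foot n) = foot (s n).
Proof.
move=> An; rewrite /feet_map; case: pselect => [e|[]]; last by exists n.
by case: cid => k /= [_ /foot_inj ->].
Qed.

Lemma feet_map_place A s F k : feet_map A s F (place 0 k) = place 0 (F k).
Proof.
rewrite /feet_map; case: pselect => [e|]; last by rewrite unplaceK.
by case: cid => n /= [_ /esym/place_neq_foot].
Qed.

Lemma mdist_place0 (k k' : Q) : mdist (place 0 k) (place 0 k') <= mdist k k'.
Proof.
by apply: le_trans (mdist_place _ _ _ _) _; rewrite ?lexx ?ler01// subrr normr0 add0r.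
Qed.

Lemma near_foot_open n (x : Q) : near_foot q n x -> \forall y \near x, near_foot q n y.
Proof.
move=> nx; have e0 : 0 < (2 ^+ n)^-1 / 16 - `|crd (foot n) 1 - crd x 1| by rewrite subr_gt0.
have cc : continuous (fun y : Q => crd y 1) by exact: continuous_crd.
have : \forall y \near x, `|crd x 1 - crd y 1| < (2 ^+ n)^-1 / 16 - `|crd (foot n) 1 - crd x 1|.
  exact: (@cvgr_dist_lt _ R^o _ _ _ _ _ (cc x)).
apply: filterS => y; rewrite /near_foot => xy.
by have := ler_distD (crd x 1) (crd (foot n) 1) (crd y 1); lra.
Qed.

Lemma place_not_near_foot (k : Q) n : ~ near_foot q n (place 0 k).
Proof.
rewrite /near_foot crd_foot1 crd_place1 ?lexx ?ler01// mul0r addr0.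
rewrite (_ : _ - _ = (2 ^+ n)^-1 / 4); last by ring.
have p : 0 < (2 ^+ n)^-1 :> R by rewrite invr_gt0 exprn_gt0.
by rewrite ger0_norm; lra.
Qed.

Section feet_map_continuous.
Context (K : hyperspace Q) (kk : nat -> Q) (s : nat -> nat) (F : Q -> Q).
Local Notation A := [set n | 0 < hair_length K n].
Hypothesis kkP : forall n, A n -> hyperspace_set K (kk n) /\ mdist (q n) (kk n) < eps n.
Hypothesis cF : continuous_on K F.
Hypothesis s_close : forall e, 0 < e ->
  exists M, forall n, A n -> (M <= n)%N -> mdist (foot (s n)) (place 0 (F (kk n))) < e.

(** A foot is isolated in [feet K] by its slab. Near a point [place 0 k] only feet of large index
    occur; for these [kk n] is close to [k], and foot [s n] is close to the copy of [F (kk n)]. *)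
Lemma feet_map_near x e : feet K x -> 0 < e ->
  \forall y \near x, feet K y -> mdist (feet_map A s F x) (feet_map A s F y) < e.
Proof.
move=> [[k Kk <-]|[n An <-]] e0; last first.
  have := near_foot_open (near_foot_self q n); apply: filterS => y ny [[k Kk ky]|[m Am my]].
    by move: ny; rewrite -ky => /place_not_near_foot.
  have nm : n = m by apply: (near_foot_inj ny); rewrite -my; exact: near_foot_self.
  by rewrite -my -nm mdistxx.
have e2 : 0 < e / 2 by rewrite divr_gt0.
have [d d0 dF] := cF Kk e2; have d2 : 0 < d / 2 by rewrite divr_gt0.
have [M1 M1P] := s_close e2; have [M2 M2P] := eps_van d2.
have far (i : 'I_(maxn M1 M2)) : \forall y \near place 0 k, y <> foot i.
  have di : 0 < mdist (place 0 k) (foot i).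
    by rewrite lt_neqAle mdist_ge0 andbT; apply/eqP => /esym/mdist_positivity/place_neq_foot.
  by apply: filterS (near_mdist (place 0 k) di) => y + yd; rewrite yd ltxx.
have und : \forall y \near place 0 k, mdist k (unplace y) < d / 2.
  have cu : continuous (unplace : Q -> Q) by exact: continuous_unplace.
  by have /continuous_mdistP/(_ (place 0 k) _ d2) := cu; rewrite unplaceK.
have FF : Filter (nbhs (place 0 k : Q)) by exact: nbhs_filter.
have fars : \forall y \near place 0 k, forall i : 'I_(maxn M1 M2), y <> foot i.
  exact: (@filter_forall _ 'I_(maxn M1 M2) _ _ FF far).
apply: filterS (filterI und fars) => y [yd yf] [[k' Kk' ky]|[n An ny]].
  rewrite -ky !feet_map_place; apply: le_lt_trans (mdist_place0 _ _) _.
  move: yd; rewrite -ky unplaceK => kd.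
  by have := dF k' Kk' (_ : mdist k k' < d); lra.
have Mn : (maxn M1 M2 <= n)%N by rewrite leqNgt; apply/negP => nM; exact: (yf (Ordinal nM)).
move: Mn; rewrite geq_max => /andP[Mn1 Mn2].
rewrite -ny feet_map_place feet_map_foot//; have [Kn qn] := kkP An.
move: yd; rewrite -ny unplaceK => kd.
have kn : mdist k (kk n) < d.
  by have := M2P n Mn2; have := metric_triangle k (q n) (kk n); lra.
have := dF _ Kn kn; have := mdist_place0 (F k) (F (kk n)); have := M1P n An Mn1.
have := metric_triangle (place 0 (F k)) (place 0 (F (kk n))) (foot (s n)).
by rewrite (metric_sym (foot _)); lra.
Qed.

Lemma feet_map_tietze : exists h : nat -> Q -> R,
  [/\ inner h, forall j, continuous (h j) &
    forall j n, A n -> h j (foot n) = crd (foot (s n)) j.*2.+1].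
Proof.
have [||h [h01 ch hE]] := @cube_tietze R (feet K) (feet_map A s F) (closed_feet eps_van (K := K)).
- apply/subspace_sigL_continuousP/continuous_mdistP => x e e0.
  have cv : continuous (set_val : set_type (feet K) -> Q) by exact: continuous_set_val.
  apply: (@filterS _ _ (nbhs_filter x) _ _ _ (cv x _ (feet_map_near (set_val_in x) e0))).
  by move=> y; apply; exact: set_val_in.
- move=> x j [[k _ <-]|[n An <-]].
    by rewrite feet_map_place crd_place_itv// lexx ler01.
  by rewrite feet_map_foot// crd_place_itv// pow2V_itv.
exists h; split => // j n An; rewrite hE; last by right; exists n.
by rewrite feet_map_foot.
Qed.
End feet_map_continuous.

Lemma closest_choice (K : hyperspace Q) : exists kk : nat -> Q, forall n,
  0 < hair_length K n -> hyperspace_set K (kk n) /\ mdist (q n) (kk n) < eps n.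
Proof.
have /choice[kk kkP] n : exists k, 0 < hair_length K n ->
    hyperspace_set K k /\ mdist (q n) k < eps n.
  have [/hair_near[k Kk nk]|n0] := pselect (0 < hair_length K n); first by exists k.
  by exists point.
by exists kk.
Qed.

(** The net has arbitrarily late points near [F (kk n)], and continuity of [G] at [F (kk n)] gives
    the second estimate. The bound in [minn n m] is symmetric, so the same relation serves for both
    directions of the matching. *)
Lemma hair_choice (K L : hyperspace Q) (kk ll : nat -> Q) (F G : Q -> Q) :
  (forall n, 0 < hair_length K n -> hyperspace_set K (kk n) /\ mdist (q n) (kk n) < eps n) ->
  (forall n, 0 < hair_length L n -> hyperspace_set L (ll n) /\ mdist (q n) (ll n) < eps n) ->
  (forall k, hyperspace_set K k -> hyperspace_set L (F k)) ->
  (forall k, hyperspace_set K k -> G (F k) = k) ->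
  continuous_on L G ->
  forall n N, 0 < hair_length K n -> exists m, [/\ (N <= m)%N, 0 < hair_length L m &
    mdist (F (kk n)) (ll m) < (2 ^+ minn n m)^-1 /\ mdist (G (ll m)) (kk n) < (2 ^+ minn n m)^-1].
Proof.
move=> kkP llP FL GK cG n N Kn; have [Kk _] := kkP _ Kn.
have p0 : 0 < (2 ^+ n)^-1 :> R by rewrite invr_gt0 exprn_gt0.
have [d d0 dG] := cG _ _ (FL _ Kk) p0.
have e0 : 0 < Num.min d (2 ^+ n)^-1 / 2 by rewrite divr_gt0// lt_min d0.
have [m [Nm m0 me mq]] := cube_net_late q_net (F (kk n)) (maxn n N) e0.
move: Nm; rewrite geq_max => /andP[nm Nm]; have Lm := hair_length_gt0 (FL _ Kk) mq.
have [Ll ml] := llP _ Lm; exists m; split => //; rewrite (minn_idPl nm).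
have : mdist (F (kk n)) (ll m) < Num.min d (2 ^+ n)^-1.
  have := metric_triangle (F (kk n)) (q m) (ll m); rewrite (metric_sym _ (q m)); lra.
rewrite lt_min => /andP[fd fp]; split => //.
by rewrite metric_sym -{1}(GK _ Kk); exact: dG.
Qed.

(** Since [t] inverts [s], large [n] have large [s n], so 2^-(s n), [eps (s n)] and the matching
    error all become small. *)
Lemma foot_close (A : set nat) (kk ll : nat -> Q) (s t : nat -> nat) (F : Q -> Q) :
  (forall n, A n -> t (s n) = n) ->
  (forall n, A n -> mdist (q (s n)) (ll (s n)) < eps (s n)) ->
  (forall n, A n -> mdist (F (kk n)) (ll (s n)) < (2 ^+ minn n (s n))^-1) ->
  forall e, 0 < e -> exists M, forall n, A n -> (M <= n)%N ->
    mdist (foot (s n)) (place 0 (F (kk n))) < e.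
Proof.
move=> sK ql Fl e e0; have e2 : 0 < e / 2 by rewrite divr_gt0.
have [M1 M1P] := pow2V_eps_van eps_van e2; have [M2 M2P] := pow2V_lt e2.
pose M := maxn M1 M2; exists (maxn M (\max_(i < M) t i).+1) => n An.
rewrite geq_max => /andP[Mn tn].
have Ms : (M <= s n)%N.
  rewrite leqNgt; apply/negP => snM; move: tn; apply/negP; rewrite -leqNgt -{1}(sK _ An).
  exact: (leq_bigmax (Ordinal snM)).
have Mm : (M2 <= minn n (s n))%N by rewrite leq_min !(leq_trans _ Mn, leq_trans _ Ms)// leq_maxr.
have := M2P _ Mm; have := M1P (s n) (leq_trans (leq_maxl _ _) Ms).
have := mdist_foot q (F (kk n)) (s n); have := ql _ An; have := Fl _ An.
have := metric_triangle (q (s n)) (ll (s n)) (F (kk n)); rewrite (metric_sym (ll _)); lra.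
Qed.

Lemma reduction_homeo (K L : hyperspace Q) : homeo_compacta K L ->
  homeo_compacta (reduction q eps01 eps_van K) (reduction q eps01 eps_van L).
Proof.
move=> [f [g [fK gK cf cg]]].
have [F [FE cF]] := total_extension cf; have [G [GE cG]] := total_extension cg.
have ins (A : set Q) x (Ax : A x) : x = set_val (insubset Ax) by rewrite val_insubset.
have FL k : hyperspace_set K k -> hyperspace_set L (F k).
  by move=> Kk; rewrite (ins _ _ Kk) FE; exact: set_val_in.
have GL k : hyperspace_set L k -> hyperspace_set K (G k).
  by move=> Kk; rewrite (ins _ _ Kk) GE; exact: set_val_in.
have FK k : hyperspace_set K k -> G (F k) = k.
  by move=> Kk; rewrite (ins _ _ Kk) FE GE fK.
have GK k : hyperspace_set L k -> F (G k) = k.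
  by move=> Kk; rewrite (ins _ _ Kk) GE FE gK.
have [kk kkP] := closest_choice K; have [ll llP] := closest_choice L.
pose P n m := mdist (F (kk n)) (ll m) < (2 ^+ minn n m)^-1 /\
  mdist (G (ll m)) (kk n) < (2 ^+ minn n m)^-1.
(* Injections in both directions respecting [P] are combined into a bijection [s] between the
   nondegenerate hairs, with inverse [t]. *)
have [u [uB uP uI]] := increasing_choice (P := P) (hair_choice kkP llP FL FK cG).
have [v [vB vP vI]] := increasing_choice (hair_choice llP kkP GL GK cF).
have vP' n : 0 < hair_length L n -> P (v n) n by move=> /vP[]; rewrite minnC.
have [s [t [sB tA sK tK sP]]] := schroeder_bernstein_rel uB uP uI vB vP' vI.
have close1 := foot_close sK (fun n An => (llP _ (sB n An)).2) (fun n An => (sP n An).1).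
have tP n : 0 < hair_length L n -> mdist (G (ll n)) (kk (t n)) < (2 ^+ minn n (t n))^-1.
  by move=> Ln; have [_] := sP _ (tA _ Ln); rewrite tK// minnC.
have close2 := foot_close tK (fun n An => (kkP _ (tA n An)).2) tP.
(* At foot [n] the functions [h] record foot [s n], and at foot [s n] the functions [g'] record foot
   [n]; this is what [klee_anchor] asks for. *)
have [h [h01 ch hE]] := feet_map_tietze kkP cF close1.
have [g' [g01 cg' gE]] := feet_map_tietze llP cG close2.
have kf n : 0 < hair_length K n -> klee h g' (foot n) = foot (s n).
  move=> Kn; apply: klee_anchor => //; [exact: anchor_place|exact: anchor_place| |].
    by move=> j; rewrite hE.
  by move=> j; rewrite gE; [rewrite sK|exact: sB].
have kg n : 0 < hair_length L n -> klee g' h (foot n) = foot (t n).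
  move=> Ln; rewrite -{1}(tK _ Ln) -kf; last exact: tA.
  by rewrite kleeK.
have T0 x := @crd_klee0 R h g' x h01 g01; have T'0 x := @crd_klee0 R g' h x g01 h01.
have Tr c x := @klee_raise R h g' c x h01 g01; have T'r c x := @klee_raise R g' h c x g01 h01.
have K01 := hair_length_itv q eps01 K; have L01 := hair_length_itv q eps01 L.
have Kv := hair_length_van q eps01 eps_van K; have Lv := hair_length_van q eps01 eps_van L.
have cT := continuous_klee h01 g01 ch cg'; have cT' := continuous_klee g01 h01 cg' ch.
pose f1 (x : set_type (brush q (hair_length K))) :=
  insubset (rescale_brush L01 sB T0 Tr kf (set_val_in x)).
pose f2 (x : set_type (brush q (hair_length L))) :=
  insubset (rescale_brush K01 tA T'0 T'r kg (set_val_in x)).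
exists f1, f2; split.
- move=> x; apply: set_val_inj; rewrite !val_insubset.
  by apply: rescaleK => //; [exact: kleeK|exact: set_val_in].
- move=> x; apply: set_val_inj; rewrite !val_insubset.
  by apply: rescaleK => //; [exact: kleeK|exact: set_val_in].
- by apply: continuous_insubset; exact: (continuous_rescale K01 L01 Lv sB sK cT).
- by apply: continuous_insubset; exact: (continuous_rescale L01 K01 Kv tA tK cT').
Qed.
End feet.

Theorem theorem6 (R : realType) :
  continuously_bireducible (@homeo_compacta R) (@homeo_AR R).
Proof.
(* The converse reduction is the inclusion of the absolute retracts. *)
split; last by exists set_val; split => // x; exact: initial_continuous.
have [q [eps [eps01 eps_van q_net]]] := cube_net R.
exists (fun K => insubset (reduction_AR q eps01 eps_van K)); split.
  by apply: continuous_insubset; exact: continuous_reduction.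
move=> K L; rewrite /homeo_AR !val_insubset; split; first exact: reduction_homeo.
exact: (@reduction_recover R q eps eps01 eps_van q_net K L).
Qed.
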